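(* Let $u^{N,\varepsilon,\delta}_{\kappa,m}$ be a solution of the penalised problem (P$_m$) described in the context. Then there is a constant $M_2=M_2(N,\kappa,\varepsilon,m)>0$ (not depending on $\delta$) such that $$\sup_{(t,x)\in\partial_P\mathcal O_m}\big|\partial_xu^{N,\varepsilon,\delta}_{\kappa,m}(t,x)\big|\le M_2 .$$
   Context: **Setting.** $T\in(0,\infty)$, $\mathcal O=[0,T)\times(0,\infty)$, $\overline{\mathcal O}=[0,T]\times[0,\infty)$; $r\ge0$, $\bar\alpha>0$ constants; $g,h:\overline{\mathcal O}\to[0,\infty)$ continuous; $(\mathcal L\varphi)(t,x)=\frac{\sigma^2(x)}2\partial_{xx}\varphi+\mu(x)\partial_x\varphi$. $C^{j,k;\gamma}_{loc}(\overline{\mathcal O})$: functions that are $\gamma$-Hölder (parabolic distance), with time derivatives up to order $j$ and space derivatives up to order $k$, on every compact subset of $\overline{\mathcal O}$; $C^{j,k;\gamma}_b(\overline{\mathcal O})$: same on all of $\overline{\mathcal O}$, with the function and derivatives bounded; $C^{1,2;\gamma}(\overline{\mathcal O}_m)$ analogous on $\overline{\mathcal O}_m$. **Assumption (SDE).** $\mu:\mathbb R\to\mathbb R$, $\sigma:\mathbb R\to[0,\infty)$ continuous, $\sigma(x)=\sigma(0)$, $\mu(x)=\mu(0)$ for $x<0$; (i) $\mu\in C^1((0,\infty))$, Lipschitz on $[0,\infty)$ with constant $D_1$; (ii) $\sigma\in C^1((0,\infty))$ and $|\sigma(x)-\sigma(y)|\le D_\gamma|x-y|^{\gamma_\sigma}$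 on $[0,\infty)$ for some $\gamma_\sigma>1/2$; (iii) $\sigma>0$ on $(0,\infty)$ and $|\mu(x)|+\sigma(x)\le D_1(1+|x|)$ on $[0,\infty)$. **Assumption (G).** (i) $g\in C^{1,2;\gamma}_{loc}(\overline{\mathcal O})$, $h\in C^{0,1;\gamma}_{loc}(\overline{\mathcal O})$ for some $\gamma\in(0,1)$, and $g(t,x)-g(s,x)\le K_0(t-s)$, $h(t,x)-h(s,x)\le K_0(t-s)$ for $0\le s\le t\le T$, $x\ge0$; (ii) $|\partial_xg|\le\bar\alpha$; (iii) $0\le h\le K_1(1+|x|^2)$, $0\le g\le K_1(1+|x|)$. With $\Theta:=h+\partial_tg+\mathcal Lg-rg$: (iv) $\Theta$ is locally Lipschitz on $\mathcal O$ and $\Theta\ge-K_2$; (v) $\liminf_{x\to\infty}\Theta(T,x)>0$, $\Theta(T,0)<0$. **Approximating data.** For $N\in\mathbb N$: $g^N\in C^{1,2;\gamma}_b(\overline{\mathcal O})$, $h^N\in C^{0,1;\gamma}_b(\overline{\mathcal O})$, $0\le g^N\le g$, $0\le h^N\le h$, $g^N+h^N\le N$; $g^N=g$ on $\{g\le N-1\}\cap\{0\le x\le N-1\}$, $h^N=h$ on $\{h\le N-1\}\cap\{0\le x\le N-1\}$; $|h^N(t,x)-h^N(s,y)|\le L_N(|x-y|+|t-s|)$, $|g^N(t,x)-g^N(s,y)|\le\bar\alpha^N(|x-y|+|t-s|)$, where $\bar\alpha^N\downarrow\bar\alpha$ as $N\to\infty$. For $\kappa\in(0,1)$: $\mu_\kappa,\sigma_\kappa\in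 C([0,\infty))\cap C^1((0,\infty))$, $|\mu_\kappa|\le\kappa^{-1}$, $\kappa\le\sigma_\kappa\le\kappa^{-1}$, $|\mu_\kappa(x)|+\sigma_\kappa(x)\le D_1(1+|x|)$, $(\mu_\kappa,\sigma_\kappa)\to(\mu,\sigma)$ uniformly on compacts of $[0,\infty)$ as $\kappa\to0$; $\mu_\kappa$ is $D_1$-Lipschitz and $\sigma_\kappa$ is $\gamma_\sigma$-Hölder with constant $D_\gamma$ on $[0,\infty)$. $\mathcal L_\kappa$ is $\mathcal L$ with $(\mu_\kappa,\sigma_\kappa)$ in place of $(\mu,\sigma)$. $\Theta^N_\kappa:=h^N+\partial_tg^N+\mathcal L_\kappa g^N-rg^N$ and $\overline\Theta^N_\kappa:=\inf\{x\ge0:\Theta^N_\kappa(T,x)=0\}$. **Localisation.** For $m\in\mathbb N$: $\zeta_m\in C^\infty([0,T])$ (depending also on $\kappa$) is non-decreasing, $\zeta_m=0$ on $[0,T-\frac1m]$, $\zeta_m(T)=\overline\Theta^N_\kappa$; $\xi_m\in C^\infty([0,\infty))$, $0\le\xi_m\le1$, $\xi_m=1$ on $[0,m]$, $\xi_m=0$ on $[m+1,\infty)$, $|\dot\xi_m|^2\le C_0\xi_m$, $|\ddot\xi_m|\le C_0$ with $C_0$ independent of $m$. $g^N_m:=\xi_{m-1}g^N$, $h^N_m:=\xi_{m-1}h^N$, $\Theta^N_{\kappa,m}:=h^N_m+\partial_tg^N_m+\mathcal L_\kappa g^N_m-rg^N_m$, and $$(\bar\alpha^N_m(t,x))^2=(\bar\alpha^N)^2+N^2|\dot\xi_m(x)|^2+2g^N(t,x)\xi_m(x)\dot\xi_m(x)\partial_xg^N(t,x).$$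 $N$, $1/\kappa$ and $m$ are assumed sufficiently large, so that in particular $0<\overline\Theta^N_\kappa=\overline\Theta^N_{\kappa,m}<m$, where $\overline\Theta^N_{\kappa,m}:=\inf\{x\ge 0:\Theta^N_{\kappa,m}(T,x)=0\}$. $\mathcal O_m=\{(t,x)\in\mathcal O:\zeta_m(t)<x<m\}$, with parabolic boundary $\partial_P\mathcal O_m=\{(t,\zeta_m(t)):t\in[0,T)\}\cup([0,T)\times\{m\})\cup(\{T\}\times[\overline\Theta^N_\kappa,m])$. **Penalised problem (P$_m$).** For $\varepsilon,\delta\in(0,1)$, $\psi_\varepsilon\in C^2(\mathbb R)$ is non-negative, convex, $\psi_\varepsilon=0$ on $(-\infty,0]$, $\psi_\varepsilon>0$ on $(0,\infty)$, $\psi_\varepsilon'\ge0$, $\psi_\varepsilon(y)=\frac{y-\varepsilon}\varepsilon$ for $y\ge2\varepsilon$. A solution is $u=u^{N,\varepsilon,\delta}_{\kappa,m}\in C^{1,2;\gamma}(\overline{\mathcal O}_m)$ with $$\partial_tu+\mathcal L_\kappa u-ru=-h^N_m-\tfrac1\delta(g^N_m-u)^++\psi_\varepsilon\big(|\partial_xu|^2-(\bar\alpha^N_m)^2\big)\ \text{on }\mathcal O_m,\qquad u=g^N_m\ \text{on }\partial_P\mathcal O_m.$$ *)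

(* Defs.v *)
From HB Require Import structures.
From mathcomp Require Import all_boot all_order all_algebra.
From mathcomp Require Import all_classical all_reals all_analysis.

Set Implicit Arguments.
Unset Strict Implicit.
Unset Printing Implicit Defensive.

Import Order.TTheory GRing.Theory Num.Theory.
Import numFieldNormedType.Exports.

Local Open Scope classical_set_scope.
Local Open Scope ring_scope.

(* Derivatives relative to a set: the difference quotient is only taken along
   points of the set, so at an end point of an interval this is the one-sided
   derivative.  A point of the space-time domain is a pair [p = (t, x)]. *)

Section Derivatives.
Variable R : realType.
Implicit Types (A : set R) (D K : set (R * R)) (p q : R * R) (x y : R).

Definition quotient_within A (f : R -> R) (x : R) :=
  (fun y => (f y - f x) / (y - x)) @ within A x^'.

Definition derivable_within A (f : R -> R) (x : R) : Prop :=
  cvg (quotient_within A f x).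

Definition derive_within A (f : R -> R) (x : R) : R :=
  lim (quotient_within A f x).

Definition smooth_on A (f : R -> R) : Prop :=
  forall n x, A x -> derivable_within A (iter n (derive_within A) f) x.

Definition C1_pos (f : R -> R) : Prop :=
  forall x, 0 < x -> derivable f x 1 /\ {for x, continuous (derive1 f)}.

Definition C2 (f : R -> R) : Prop :=
  [/\ forall x, derivable f x 1,
      forall x, derivable (derive1 f) x 1 &
      continuous (derive1n 2 f)].

Definition derivable_t D (f : R * R -> R) p : Prop :=
  derivable_within (fun t => D (t, p.2)) (fun t => f (t, p.2)) p.1.

Definition derivable_x D (f : R * R -> R) p : Prop :=
  derivable_within (fun x => D (p.1, x)) (fun x => f (p.1, x)) p.2.

Definition partial_t D (f : R * R -> R) p : R :=
  derive_within (fun t => D (t, p.2)) (fun t => f (t, p.2)) p.1.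

Definition partial_x D (f : R * R -> R) p : R :=
  derive_within (fun x => D (p.1, x)) (fun x => f (p.1, x)) p.2.

Definition parabolic_dist p q : R :=
  `|p.2 - q.2| + Num.sqrt `|p.1 - q.1|.

Definition parabolic_holder (gamma : R) K (f : R * R -> R) : Prop :=
  exists C : R, forall p q, K p -> K q ->
    `|f p - f q| <= C * parabolic_dist p q `^ gamma.

Definition has_derivs (j k : nat) D (f : R * R -> R) : Prop :=
  (forall i p, (i < j)%N -> D p -> derivable_t D (iter i (partial_t D) f) p) /\
  (forall i p, (i < k)%N -> D p -> derivable_x D (iter i (partial_x D) f) p).

Definition holder_derivs (gamma : R) (j k : nat) D K (f : R * R -> R) : Prop :=
  (forall i, (i <= j)%N -> parabolic_holder gamma K (iter i (partial_t D) f)) /\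
  (forall i, (i <= k)%N -> parabolic_holder gamma K (iter i (partial_x D) f)).

Definition bounded_derivs (j k : nat) D (f : R * R -> R) : Prop :=
  (forall i, (i <= j)%N -> [bounded iter i (partial_t D) f p | p in D]) /\
  (forall i, (i <= k)%N -> [bounded iter i (partial_x D) f p | p in D]).

(* C^{j,k;gamma}_loc(D) *)
Definition Cloc (gamma : R) (j k : nat) D (f : R * R -> R) : Prop :=
  has_derivs j k D f /\
  forall K, compact K -> K `<=` D -> holder_derivs gamma j k D K f.

(* C^{j,k;gamma}_b(D); for a compact D this is also C^{j,k;gamma}(D). *)
Definition Cb (gamma : R) (j k : nat) D (f : R * R -> R) : Prop :=
  [/\ has_derivs j k D f, holder_derivs gamma j k D D f &
      bounded_derivs j k D f].

End Derivatives.

Section Problem.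
Variable R : realType.
Implicit Types (T r kappa gamma : R) (mu sigma zeta psi : R -> R).
Implicit Types (g h u : R * R -> R) (xi : nat -> R -> R) (N m : nat).
Implicit Types (s t x y : R) (p q : R * R).

Definition spacetime T : set (R * R) := [set p | 0 <= p.1 < T /\ 0 < p.2].

Definition spacetimebar T : set (R * R) := [set p | 0 <= p.1 <= T /\ 0 <= p.2].

(* [D] is the domain relative to which the derivatives are taken. *)
Definition opL mu sigma (D : set (R * R)) g (p : R * R) : R :=
  sigma p.2 ^+ 2 / 2 * partial_x D (partial_x D g) p
  + mu p.2 * partial_x D g p.

Definition Theta T r mu sigma h g (p : R * R) : R :=
  h p + partial_t (spacetimebar T) g p + opL mu sigma (spacetimebar T) g p - r * g p.

(* inf {x >= 0 : f x = 0}, equal to +oo when there is no such x *)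
Definition first_zero (f : R -> R) : \bar R :=
  ereal_inf [set x%:E | x in [set x : R | 0 <= x /\ f x = 0]].

Record assumption_SDE mu sigma (D1 Dgamma gamma_sigma : R) : Prop := {
  sde_mu_continuous : continuous mu;
  sde_sigma_continuous : continuous sigma;
  sde_sigma_ge0 : forall x, 0 <= sigma x;
  sde_const_neg : forall x, x < 0 -> sigma x = sigma 0 /\ mu x = mu 0;
  sde_mu_C1 : C1_pos mu;
  sde_mu_lipschitz : forall x y, 0 <= x -> 0 <= y ->
    `|mu x - mu y| <= D1 * `|x - y|;
  sde_sigma_C1 : C1_pos sigma;
  sde_gamma_sigma : 1 / 2 < gamma_sigma;
  sde_sigma_holder : forall x y, 0 <= x -> 0 <= y ->
    `|sigma x - sigma y| <= Dgamma * `|x - y| `^ gamma_sigma;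
  sde_sigma_gt0 : forall x, 0 < x -> 0 < sigma x;
  sde_growth : forall x, 0 <= x -> `|mu x| + sigma x <= D1 * (1 + `|x|) }.

Record assumption_G T r (alpha gamma : R) mu sigma g h (K0 K1 K2 : R)
    : Prop := {
  G_g_continuous : {within spacetimebar T, continuous g};
  G_h_continuous : {within spacetimebar T, continuous h};
  G_gamma : 0 < gamma < 1;
  G_g_reg : Cloc gamma 1 2 (spacetimebar T) g;
  G_h_reg : Cloc gamma 0 1 (spacetimebar T) h;
  G_time : forall s t x, 0 <= s -> s <= t -> t <= T -> 0 <= x ->
    g (t, x) - g (s, x) <= K0 * (t - s) /\ h (t, x) - h (s, x) <= K0 * (t - s);
  G_gradient : forall p, spacetimebar T p -> `|partial_x (spacetimebar T) g p| <= alpha;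
  G_h_growth : forall p, spacetimebar T p -> 0 <= h p <= K1 * (1 + `|p.2| ^+ 2);
  G_g_growth : forall p, spacetimebar T p -> 0 <= g p <= K1 * (1 + `|p.2|);
  G_Theta_lipschitz : forall p, spacetime T p ->
    exists2 U, nbhs p U &
      [lipschitz Theta T r mu sigma h g q | q in spacetime T `&` U];
  G_Theta_lower : forall p, spacetime T p -> - K2 <= Theta T r mu sigma h g p;
  G_Theta_liminf :
    (0 < limf_einf (fun x : R => (Theta T r mu sigma h g (T, x))%:E) +oo%R)%E;
  G_Theta_zero : Theta T r mu sigma h g (T, 0) < 0 }.

Record approx_payoffs T (alpha gamma : R) g h (gN hN : nat -> R * R -> R)
    (LN alphaN : nat -> R) : Prop := {
  approx_g_reg : forall N, (0 < N)%N -> Cb gamma 1 2 (spacetimebar T) (gN N);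
  approx_h_reg : forall N, (0 < N)%N -> Cb gamma 0 1 (spacetimebar T) (hN N);
  approx_g_le : forall N p, (0 < N)%N -> spacetimebar T p -> 0 <= gN N p <= g p;
  approx_h_le : forall N p, (0 < N)%N -> spacetimebar T p -> 0 <= hN N p <= h p;
  approx_sum_le : forall N p, (0 < N)%N -> spacetimebar T p ->
    gN N p + hN N p <= N%:R;
  approx_g_eq : forall N p, (0 < N)%N -> spacetimebar T p ->
    g p <= N%:R - 1 -> p.2 <= N%:R - 1 -> gN N p = g p;
  approx_h_eq : forall N p, (0 < N)%N -> spacetimebar T p ->
    h p <= N%:R - 1 -> p.2 <= N%:R - 1 -> hN N p = h p;
  approx_h_lipschitz : forall N p q, (0 < N)%N -> spacetimebar T p -> spacetimebar T q ->
    `|hN N p - hN N q| <= LN N * (`|p.2 - q.2| + `|p.1 - q.1|);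
  approx_g_lipschitz : forall N p q, (0 < N)%N -> spacetimebar T p -> spacetimebar T q ->
    `|gN N p - gN N q| <= alphaN N * (`|p.2 - q.2| + `|p.1 - q.1|);
  approx_alpha_noninc : forall N M, (0 < N)%N -> (N <= M)%N ->
    alphaN M <= alphaN N;
  approx_alpha_cvg : alphaN @ \oo --> alpha }.

(* The coefficients are only relevant on [0, +oo[. *)
Record approx_coeffs mu sigma (D1 Dgamma gamma_sigma : R)
    (muk sigmak : R -> R -> R) : Prop := {
  coeffs_continuous : forall kappa, 0 < kappa < 1 ->
    {within `[0, +oo[, continuous (muk kappa)} /\
    {within `[0, +oo[, continuous (sigmak kappa)};
  coeffs_C1 : forall kappa, 0 < kappa < 1 ->
    C1_pos (muk kappa) /\ C1_pos (sigmak kappa);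
  coeffs_bounds : forall kappa x, 0 < kappa < 1 -> 0 <= x ->
    `|muk kappa x| <= kappa^-1 /\ kappa <= sigmak kappa x <= kappa^-1;
  coeffs_growth : forall kappa x, 0 < kappa < 1 -> 0 <= x ->
    `|muk kappa x| + sigmak kappa x <= D1 * (1 + `|x|);
  coeffs_mu_cvg : forall K : set R, compact K -> K `<=` `[0, +oo[ ->
    {uniform K, muk @ 0^'+ --> mu};
  coeffs_sigma_cvg : forall K : set R, compact K -> K `<=` `[0, +oo[ ->
    {uniform K, sigmak @ 0^'+ --> sigma};
  coeffs_mu_lipschitz : forall kappa x y, 0 < kappa < 1 -> 0 <= x -> 0 <= y ->
    `|muk kappa x - muk kappa y| <= D1 * `|x - y|;
  coeffs_sigma_holder : forall kappa x y, 0 < kappa < 1 -> 0 <= x -> 0 <= y ->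
    `|sigmak kappa x - sigmak kappa y| <= Dgamma * `|x - y| `^ gamma_sigma }.

Notation dxi := (derive_within `[0, +oo[).

Record cutoffs xi (C0 : R) : Prop := {
  cutoff_smooth : forall m, smooth_on `[0, +oo[ (xi m);
  cutoff_range : forall m x, 0 <= x -> 0 <= xi m x <= 1;
  cutoff_one : forall m x, 0 <= x -> x <= m%:R -> xi m x = 1;
  cutoff_zero : forall m x, m%:R + 1 <= x -> xi m x = 0;
  cutoff_deriv : forall m x, 0 <= x -> `|dxi (xi m) x| ^+ 2 <= C0 * xi m x;
  cutoff_deriv2 : forall m x, 0 <= x -> `|dxi (dxi (xi m)) x| <= C0 }.

(* [thetabar] stands for the first zero of Theta^N_kappa(T, .). *)
Record moving_boundary T m (thetabar : \bar R) zeta : Prop := {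
  zeta_smooth : smooth_on `[0, T] zeta;
  zeta_nondecreasing : forall s t, 0 <= s -> s <= t -> t <= T ->
    zeta s <= zeta t;
  zeta_zero : forall t, 0 <= t -> t <= T - m%:R^-1 -> zeta t = 0;
  zeta_terminal : (zeta T)%:E = thetabar }.

(* The localised data g^N_m and h^N_m; note the index m - 1 of the cutoff. *)
Definition localise xi m g (p : R * R) : R := xi m.-1 p.2 * g p.

(* The square of alphabar^N_m, given gN = g^N and a = alphabar^N; here the
   index of the cutoff is m. *)
Definition alpha_m_sq T xi N m (a : R) (gN : R * R -> R) (p : R * R) : R :=
  a ^+ 2 + N%:R ^+ 2 * `|dxi (xi m) p.2| ^+ 2
  + 2 * gN p * xi m p.2 * dxi (xi m) p.2 * partial_x (spacetimebar T) gN p.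

Definition Om T m zeta : set (R * R) :=
  [set p | spacetime T p /\ zeta p.1 < p.2 < m%:R].

Definition parabolic_boundary T m (thetabar : \bar R) zeta : set (R * R) :=
  [set p | 0 <= p.1 < T /\ p.2 = zeta p.1] `|`
  [set p | 0 <= p.1 < T /\ p.2 = m%:R] `|`
  [set p | p.1 = T /\ (thetabar <= p.2%:E)%E /\ p.2 <= m%:R].

Record penalty (eps : R) psi : Prop := {
  penalty_C2 : C2 psi;
  penalty_ge0 : forall y, 0 <= psi y;
  penalty_convex : convex_function setT psi;
  penalty_zero : forall y, y <= 0 -> psi y = 0;
  penalty_gt0 : forall y, 0 < y -> 0 < psi y;
  penalty_deriv_ge0 : forall y, 0 <= derive1 psi y;
  penalty_linear : forall y, 2 * eps <= y -> psi y = (y - eps) / eps }.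

(* Problem (P_m), with g_m = g^N_m, h_m = h^N_m, alpha2 the square of
   alphabar^N_m, and (mu, sigma) the regularised coefficients. *)
Record penalised_solution T r (gamma delta : R) mu sigma psi
    (g_m h_m alpha2 : R * R -> R) (D bdD : set (R * R)) u : Prop := {
  solution_reg : Cb gamma 1 2 (closure D) u;
  solution_pde : forall p, D p ->
    partial_t (closure D) u p + opL mu sigma (closure D) u p - r * u p =
    - h_m p - delta^-1 * Num.max (g_m p - u p) 0
    + psi (`|partial_x (closure D) u p| ^+ 2 - alpha2 p);
  solution_bd : forall p, bdD p -> u p = g_m p }.

End Problem.

(* Main.v *)
(* The gradient on the boundary is controlled by barriers that do not see delta.
   Write y for the distance to one of the lateral sides, x - zeta(t) or m - x.

   Above: where u > g_m the obstacle term vanishes and the gradient penalty has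
   the good sign, so g_m + K/l (1 - exp(-l y)) is a supersolution.

   Below: psi_eps grows at most quadratically in the gradient, which is absorbed by
   the logarithmic barrier g_m - ln(1 + b y)/a; where u lies below it, the
   obstacle term is at least (g_m - u)/delta >= g_m - u, since delta < 1.

   The barriers are non-increasing in time since zeta is non-decreasing; both have
   linear growth in y, and u = g_m on the boundary, which bounds the difference
   quotients of u there. *)
Require Import Defs.
From HB Require Import structures.
From mathcomp Require Import all_boot all_order all_algebra.
From mathcomp Require Import all_classical all_reals all_analysis.
From mathcomp Require Import ring lra.
Set Implicit Arguments.
Unset Strict Implicit.
Unset Printing Implicit Defensive.

Import Order.TTheory GRing.Theory Num.Theory.
Import numFieldNormedType.Exports.
Local Open Scope classical_set_scope.
Local Open Scope ring_scope.

(** * Derivatives relative to a set, and the second-order test at a maximum *)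

Section DerivativesWithin.
Variable R : realType.
Implicit Types (A : set R) (f : R -> R) (x : R).

(** At an interior point the restriction to [A] is vacuous near [x]. This gives access to the
    calculus rules for [is_derive] inside the domain. *)
Lemma derivable_within_is_derive A f x :
  (\forall y \near x, A y) -> derivable_within A f x ->
  is_derive x 1 f (derive_within A f x).
Proof.
move=> Ax fx.
have {}fx : quotient_within A f x --> derive_within A f x by [].
have qx : (fun h : R => h^-1 *: (f (h *: 1 + x) - f x)) @ 0^' --> derive_within A f x.
  apply: cvg_trans fx => B [e /= e0 eB].
  move/nbhs_ballP: Ax => [d /= d0 dA].
  exists (Num.min e d) => /=; first by rewrite lt_min e0.
  move=> h /=; rewrite sub0r normrN lt_min => /andP[he hd] h0.
  have := eB (h + x); rewrite /ball_ /= opprD addrCA subrr addr0 normrN => /(_ he).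
  have -> : h *: 1 + x = h + x by rewrite /GRing.scale /= mulr1.
  rewrite addrK => hB; rewrite /GRing.scale /= mulrC; apply: hB.
    by rewrite -subr_eq0 addrK.
  by apply: dA; rewrite /ball /= opprD addrCA subrr addr0 normrN.
by apply: DeriveDef; [apply/cvg_ex; exists (derive_within A f x)|exact: cvg_lim qx].
Qed.

(** The forward quotient is what remains of a time derivative at [t = 0], where no earlier times
    belong to the domain. *)
Lemma derivable_within_cvg_right A f x :
  (\forall y \near x^'+, A y) -> derivable_within A f x ->
  (fun y => (f y - f x) / (y - x)) @ x^'+ --> derive_within A f x.
Proof.
move=> Ax fx.
have {}fx : quotient_within A f x --> derive_within A f x by [].
apply: cvg_trans fx; apply: cvg_app => B /= [e /= e0 eB].
move: Ax => [d /= d0 dA].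
exists (Num.min e d) => /=; first by rewrite lt_min e0.
move=> y /=; rewrite lt_min => /andP[he hd] xy.
by apply: eB => //; [rewrite gt_eqF|exact: dA].
Qed.

Lemma derivable_within_continuous_within A f x :
  derivable_within A f x -> f @ within A (nbhs x) --> f x.
Proof.
move=> fx; have {}fx : quotient_within A f x --> derive_within A f x by [].
set l := derive_within A f x in fx.
apply/cvgrPdist_lt => e e0.
have k0 : 0 < `|l| + 1 by rewrite ltr_wpDl.
have /cvgrPdist_lt /(_ 1 ltr01)[d /= d0 dq] := fx.
exists (Num.min d (e / (`|l| + 1))) => /=; first by rewrite lt_min d0 divr_gt0.
move=> y /=; rewrite lt_min => /andP[yd ye] Ay.
have [->|yx] := eqVneq y x; first by rewrite subrr normr0.
have {}dq := dq y yd yx Ay.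
have yx0 : 0 < `|y - x| by rewrite normr_gt0 subr_eq0.
have : `|(f y - f x) / (y - x)| <= `|l| + 1.
  rewrite -[X in `|X|](subKr l) (le_trans (ler_normB _ _))// lerD2l.
  exact: ltW.
rewrite normrM normfV ler_pdivrMr// distrC => /le_lt_trans; apply.
by rewrite mulrC -ltr_pdivlMr// distrC.
Qed.

(** The point [c] provides a segment of [A] issuing from [x]. It makes the filter of the quotients
    proper, so a bound on the quotients passes to their limit, also at an end point of an
    interval. *)
Lemma derive_within_norm_le A f x (B c : R) :
  derivable_within A f x -> c != x -> (forall y, `|y - x| <= `|c - x| ->
     0 <= (y - x) / (c - x) -> A y) ->
  (forall y, A y -> `|f y - f x| <= B * `|y - x|) ->
  `|derive_within A f x| <= B.
Proof.
move=> fx cx cA fB; have {}fx : quotient_within A f x --> derive_within A f x by [].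
have PF : ProperFilter (within A x^').
  apply: Build_ProperFilter_ex => C [e /= e0 eC].
  (* A fraction of the way from [x] to [c]: at most 1, to stay on the segment, and small enough to
     stay within [e / 2] of [x]. *)
  pose y := x + Num.min (e / 2 / `|c - x|) 1 * (c - x).
  have cx0 : 0 < `|c - x| by rewrite normr_gt0 subr_eq0.
  set k := Num.min _ _ in y.
  have k0 : 0 < k by rewrite lt_min ltr01 !divr_gt0.
  have yx : y - x = k * (c - x) by rewrite /y addrC addKr.
  exists y; apply: eC => /=.
  - rewrite distrC yx normrM (gtr0_norm k0) -ltr_pdivlMr//.
    rewrite (@le_lt_trans _ _ (e / 2 / `|c - x|)) ?ge_min ?lexx//.
    by rewrite ltr_pM2r ?invr_gt0// ltr_pdivrMr// ltr_pMr// ltr1n.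
  - by rewrite -subr_eq0 yx mulf_neq0 ?subr_eq0 ?(gt_eqF k0).
  - apply: cA; rewrite yx.
      by rewrite normrM (gtr0_norm k0) ler_piMl ?normr_ge0// ge_min lexx orbT.
    by rewrite mulfK ?subr_eq0// ltW.
apply: (cvgr_to_le (cvg_norm fx)).
exists 1 => //= y _ yx Ay.
by rewrite normrM normfV ler_pdivrMr ?normr_gt0 ?subr_eq0//; exact: fB.
Qed.

Lemma right_quotient_le0 f x (l : R) :
  (\forall y \near x^'+, f y <= f x) ->
  (fun y => (f y - f x) / (y - x)) @ x^'+ --> l -> l <= 0.
Proof.
move=> fx fl; apply: (cvgr_to_le fl).
near=> y; apply: mulr_le0_ge0.
  by rewrite subr_le0; near: y.
by rewrite invr_ge0 subr_ge0 ltW//; near: y; exact: nbhs_right_gt.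
Unshelve. all: by end_near. Qed.

(** The first derivative vanishes at the maximum. If [f2] were positive, [f1] would be positive just
    to the right of [x], and the mean value theorem would make [f] exceed [f x] there. *)
Lemma local_max_second_derivative (f f1 : R -> R) (x f2 : R) :
  {near x, forall y : R, is_derive y 1 f (f1 y)} -> is_derive x 1 f1 f2 ->
  (\forall y \near x, f y <= f x) -> f1 x = 0 /\ f2 <= 0.
Proof.
move=> ff1 f1f2 fmax.
have [e /= e0 eP] : nbhs x [set y : R | is_derive y 1 f (f1 y) /\ f y <= f x].
  by apply: filterI.
have inP y : y \in `](x - e), (x + e)[ -> is_derive y 1 f (f1 y) /\ f y <= f x.
  rewrite in_itv /= => /andP[a b]; apply: eP => /=.
  by rewrite ltr_distl; apply/andP; split; lra.
have xin : x \in `](x - e), (x + e)[.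
  by rewrite in_itv /= ltrBlDr ltrDl e0.
have f1x : f1 x = 0.
  have h0 : is_derive x 1 f 0.
    apply: (@derive1_at_max _ f (x - e) (x + e)) => //; first by lra.
      by move=> t /inP[[]].
    by move=> t /inP[].
  by have [[_ <-] _] := inP x xin; rewrite derive_val.
split=> //; rewrite leNgt; apply/negP => f2p.
have [df1 f2E] := f1f2.
have : (fun h : R => h^-1 *: (f1 (h *: 1 + x) - f1 x)) @ 0^' --> f2.
  by rewrite -f2E.
move=> /cvgrPdist_lt /(_ _ f2p)[d /= d0 dP].
have f1p y : x < y -> y < x + d -> 0 < f1 y.
  move=> xy yd; have h0 : 0 < y - x by rewrite subr_gt0.
  have /= := dP (y - x); rewrite sub0r normrN gtr0_norm// ltrBlDl => /(_ yd).
  rewrite gt_eqF// => /(_ isT).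
  rewrite /GRing.scale /= mulr1 subrK f1x subr0 ltr_distlC => /andP[+ _].
  by rewrite subrr pmulr_rgt0 // invr_gt0.
pose y := x + Num.min d e / 2.
have me0 : 0 < Num.min d e by rewrite lt_min d0.
have [/= md me] : Num.min d e <= d /\ Num.min d e <= e.
  by rewrite !ge_min !lexx orbT.
have xy : x < y by rewrite /y; lra.
have sub z : z \in `[x, y] -> z \in `](x - e), (x + e)[.
  by rewrite !in_itv /= /y => /andP[? ?]; apply/andP; split; lra.
have [c cin fc] : exists2 c, c \in `]x, y[ & f y - f x = f1 c * (y - x).
  apply: MVT => //.
    by move=> z zin; have [] := inP z (sub _ (subset_itv_oo_cc zin)).
  apply: derivable_within_continuous => z /sub /inP[[]] //.
move: cin; rewrite in_itv /= => /andP[xc cy].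
have : 0 < f y - f x.
  by rewrite fc mulr_gt0 ?subr_gt0//; apply: f1p => //; rewrite /y in cy; lra.
rewrite subr_gt0 ltNge.
have yin : y \in `[x, y] by rewrite in_itv /= (ltW xy) lexx.
by have [_ ->] := inP y (sub y yin).
Qed.

End DerivativesWithin.

(** * Geometry of the domain with a moving left boundary, and the comparison principle *)

Section MovingDomain.
Variables (R : realType) (T : R) (m : nat) (zeta : R -> R).
Hypotheses (T_gt0 : 0 < T) 
  (zeta_cont : forall t, 0 <= t <= T -> zeta @ within `[0, T] (nbhs t) --> zeta t)
  (zeta_nd : forall s t, 0 <= s -> s <= t -> t <= T -> zeta s <= zeta t)
  (zeta0 : 0 <= zeta 0) (zeta_lt : zeta T < m%:R).

Notation D := (Om T m zeta).

Lemma closure_Om :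
  closure D = [set p : R * R | 0 <= p.1 <= T /\ zeta p.1 <= p.2 <= m%:R].
Proof.
apply/seteqP; split => [[t x] Dp|[t x] /= [/andP[t0 tT] /andP[zx xm]]].
  have {}Dp e : 0 < e -> exists q, [/\ D q, `|t - q.1| < e & `|x - q.2| < e].
    move=> e0; have [q [Dq [/= qt qx]]] := Dp _ (nbhsx_ballx (t, x) e e0).
    by exists q.
  have tT : 0 <= t <= T.
    apply/andP; split; apply/ler_addgt0Pr => e e0.
      have [q [[[/andP[? ?] ?] _]]] := Dp e e0.
      by rewrite !ltr_distl => /andP[? ?] _; lra.
    have [q [[[/andP[? ?] ?] _]]] := Dp e e0.
    by rewrite !ltr_distl => /andP[? ?] _; lra.
  split=> //=; apply/andP; split; apply/ler_addgt0Pr => e e0; last first.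
    have [q [[_ /andP[? ?]]]] := Dp e e0.
    by rewrite !ltr_distl => _ /andP[? ?]; lra.
  have /cvgrPdist_lt/(_ (e / 2)) := zeta_cont tT.
  rewrite divr_gt0// => /(_ isT)[d /= d0 dP].
  have de : 0 < Num.min d (e / 2) by rewrite lt_min d0 divr_gt0.
  have [q [[[/andP[q0 qT] _] /andP[zq _]]]] := Dp _ de.
  rewrite !lt_min => /andP[qd _] /andP[_ qe].
  have := dP _ qd; rewrite /= in_itv /= q0 (ltW qT) => /(_ isT).
  by move: qe; rewrite !ltr_distl => /andP[? ?] /andP[? ?]; lra.
pose c := (zeta t + m%:R) / 2.
have zT : zeta t <= zeta T by apply: zeta_nd.
have zt0 : 0 <= zeta t by rewrite (le_trans zeta0)// zeta_nd.
(* The point is pulled back in time, away from [T], and towards the midpoint [c] of its slice. As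
   [zeta] is non-decreasing, it stays to the right of the boundary at the earlier time. At [t = 0]
   time does not move, which is harmless since [0 < T]. *)
pose f (k : R) : R * R := (t - k * t, x + k * (c - x)).
have f0 : f @ 0^'+ --> ((t, x) : R * R).
  have -> : ((t, x) : R * R) = f 0 by rewrite /f !mul0r subr0 addr0.
  have f1 : (fun k => t - k * t) @ (0 : R) --> t - 0 * t.
    by apply: cvgB; [exact: cvg_cst|apply: cvgMl; exact: cvg_id].
  have f2 : (fun k => x + k * (c - x)) @ (0 : R) --> x + 0 * (c - x).
    by apply: cvgD; [exact: cvg_cst|apply: cvgMl; exact: cvg_id].
  by apply: cvg_within_filter; exact: cvg_pair f1 f2.
apply: (closed_cvg _ (@closed_closure _ D) _ _ f0).
near=> k; apply: subset_closure.
have k0 : 0 < k by near: k; exact: nbhs_right_gt.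
have k1 : k < 1 by near: k; exact: nbhs_right_lt.
have kt : 0 <= k * t by rewrite mulr_ge0// ltW.
have ts0 : 0 <= t - k * t by nra.
have tsT : t - k * t < T.
  have [t00|tp] := eqVneq t 0; first by rewrite t00 mulr0 subr0.
  have : 0 < t by rewrite lt_neqAle eq_sym tp.
  by nra.
have zs : zeta (t - k * t) <= zeta t by apply: zeta_nd => //; lra.
have zm : 0 < k * (m%:R - zeta t).
  by rewrite mulr_gt0// subr_gt0 (le_lt_trans zT).
have kx : 0 <= (1 - k) * (x - zeta t) by rewrite mulr_ge0// subr_ge0// ltW.
have km : 0 <= (1 - k) * (m%:R - x) by rewrite mulr_ge0// subr_ge0// ltW.
have xE : x + k * (c - x) = (1 - k) * x + k * (zeta t + m%:R) / 2.
  by rewrite /c; field.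
split; first by split => /=; [rewrite ts0|rewrite xE; lra].
by rewrite /= xE; apply/andP; split; lra.
Unshelve. all: by end_near. Qed.

Lemma compact_closure_Om : compact (closure D).
Proof.
apply: (subclosed_compact (@closed_closure _ D)
  (compact_setX (@segment_compact _ 0 T) (@segment_compact _ 0 m%:R))).
rewrite closure_Om => -[t x] /= [/andP[t0 tT] /andP[zx xm]].
rewrite !in_itv /= t0 tT xm (le_trans zeta0)// (le_trans _ zx)//.
exact: zeta_nd.
Qed.

Lemma Om_near_x p : D p -> \forall x \near p.2, D (p.1, x).
Proof.
move=> [[tT x0] /andP[zx xm]].
have : \forall x \near p.2, x \in `](zeta p.1), m%:R[.
  by apply: near_in_itvoo; rewrite in_itv /= zx.
apply: filterS => x; rewrite in_itv /= => /andP[zx' xm'].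
split=> /=; last by rewrite zx'.
split=> //=; rewrite (le_lt_trans _ zx')// (le_trans zeta0)//.
by move/andP: tT => [? ?]; apply: zeta_nd => //; exact: ltW.
Qed.

(** Going forward, the left boundary may advance towards the point, but by continuity of [zeta] it
    does not reach it within a short time. *)
Lemma Om_near_t p : D p -> \forall t \near p.1^'+, D (t, p.2).
Proof.
move=> [[/andP[t0 tT] x0] /andP[zx xm]].
have ptT : 0 <= p.1 <= T by rewrite t0 ltW.
have /cvgr_lt/(_ _ zx)[d /= d0 dP] := zeta_cont ptT.
near=> t.
have pt : p.1 < t by near: t; exact: nbhs_right_gt.
have tT' : t < T by near: t; exact: nbhs_right_lt.
split; first by split => //=; rewrite tT' andbT ltW// (le_lt_trans t0).
rewrite /= xm andbT; apply: dP => /=.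
  rewrite distrC gtr0_norm ?subr_gt0// ltrBlDr addrC.
  by near: t; apply: nbhs_right_lt; rewrite ltrDl.
by rewrite in_itv /= (ltW tT') ltW// (le_lt_trans t0).
Unshelve. all: by end_near. Qed.

Lemma closure_Om_boundary p : closure D p -> ~ D p ->
  parabolic_boundary T m (zeta T)%:E zeta p.
Proof.
rewrite closure_Om; case: p => t x [/= /andP[t0 tT] /andP[zx xm]] nD.
have [tT'|Tt] := ltP t T; last first.
  have tE : t = T by apply/eqP; rewrite eq_le tT.
  by right; split => //=; rewrite lee_fin -tE.
left; have [xE|xz] := eqVneq x (zeta t); first by left; rewrite /= t0.
right; split => /=; first by rewrite t0.
apply/eqP; rewrite eq_le xm leNgt; apply/negP => xm'; apply: nD.
have zx' : zeta t < x by rewrite lt_neqAle eq_sym xz.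
split=> /=; last by rewrite zx'.
split=> /=; first by rewrite t0.
by rewrite (le_lt_trans _ zx')// (le_trans zeta0)// zeta_nd.
Qed.

(* Only a one-sided time derivative is available at [t = 0]; since [P] is
   non-increasing in time, the forward difference quotients of [v] suffice, and
   [P] need not be differentiable in time. *)
Lemma comparison (v P vt vx vxx Px Pxx : R * R -> R) :
  {within closure D, continuous v} -> {within closure D, continuous P} ->
  (forall p, parabolic_boundary T m (zeta T)%:E zeta p -> v p <= P p) ->
  (forall p, D p -> is_derive p.2 1 (fun x => v (p.1, x)) (vx p)) ->
  (forall p, D p -> is_derive p.2 1 (fun x => vx (p.1, x)) (vxx p)) ->
  (forall p, D p -> is_derive p.2 1 (fun x => P (p.1, x)) (Px p)) ->
  (forall p, D p -> is_derive p.2 1 (fun x => Px (p.1, x)) (Pxx p)) ->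
  (forall p, D p ->
    (fun t => (v (t, p.2) - v p) / (t - p.1)) @ p.1^'+ --> vt p) ->
  (forall s t x, closure D (s, x) -> closure D (t, x) -> s <= t ->
    P (t, x) <= P (s, x)) ->
  (forall p, D p -> P p < v p -> vx p = Px p -> vxx p <= Pxx p ->
    vt p <= 0 -> False) ->
  forall p, closure D p -> v p <= P p.
Proof.
move=> vc Pc vbd vxP vxxP PxP PxxP vtP Pt absurd q Qq.
have vPc : {within closure D, continuous (v - P)}.
  by move=> x; apply: cvgB; [exact: vc|exact: Pc].
(* If [v > P] somewhere, the maximum of [v - P] on the compact closure is positive. The boundary
   inequality then forces the maximum point [p] into [D], where the derivative tests apply. *)
have [|p Qp pmax] := compact_EVT_max _ compact_closure_Om vPc.
  by exists q.
rewrite leNgt; apply/negP => vPq.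
have Pvp : P p < v p.
  by rewrite -subr_gt0 (lt_le_trans _ (pmax q _)) ?inE// subr_gt0.
have Dp : D p.
  apply: contrapT => /(closure_Om_boundary (set_mem Qp))/vbd.
  by rewrite leNgt Pvp.
have {}pmax r : closure D r -> v r - P r <= v p - P p.
  by move=> Qr; apply: pmax; rewrite inE.
have pE : p = (p.1, p.2) by case: (p).
have Dx := Om_near_x Dp.
have [dx dxx] : vx p - Px p = 0 /\ vxx p - Pxx p <= 0.
  rewrite pE; apply: (@local_max_second_derivative _
      (fun x => v (p.1, x) - P (p.1, x))
      (fun x => vx (p.1, x) - Px (p.1, x)) p.2).
  - apply: filterS Dx => x Dx.
    by apply: is_deriveB; [exact: (vxP _ Dx)|exact: (PxP _ Dx)].
  - by rewrite -pE; apply: is_deriveB; [exact: vxxP|exact: PxxP].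
  - by apply: filterS Dx => x /subset_closure /pmax; rewrite -pE.
apply: (absurd p Dp Pvp).
- by apply/eqP; rewrite -subr_eq0 dx.
- by rewrite -subr_le0.
(* By maximality, [v (t, p.2) - v p] is at most [P (t, p.2) - P p], which is non-positive for later
   [t]. *)
- apply: (@right_quotient_le0 _ (fun t => v (t, p.2)) p.1); last first.
    by rewrite -pE; exact: vtP.
  near=> t; rewrite -pE.
  have pt : p.1 < t by near: t; exact: nbhs_right_gt.
  have Qt : closure D (t, p.2).
    by apply: subset_closure; near: t; exact: Om_near_t.
  have Pt' : P (t, p.2) <= P p.
    rewrite [X in _ <= P X]pE; apply: (Pt _ _ _ _ Qt (ltW pt)).
    by rewrite -pE; exact: subset_closure.
  by have := pmax _ Qt; lra.
Unshelve. all: by end_near. Qed.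

End MovingDomain.

(** * From the regularity class to usable derivatives at interior points *)

Section HasDerivs.
Variables (R : realType) (D K : set (R * R)) (f : R * R -> R).
Hypothesis f_reg : has_derivs 1 2 K f.
Variable p : R * R.
Hypothesis Kp : K p.

Lemma has_derivs_x : (\forall x \near p.2, K (p.1, x)) ->
  is_derive p.2 1 (fun x => f (p.1, x)) (partial_x K f p).
Proof.
by move=> Kx; apply: derivable_within_is_derive => //; exact: (f_reg.2 0%N).
Qed.

Lemma has_derivs_xx : (\forall x \near p.2, K (p.1, x)) ->
  is_derive p.2 1 (fun x => partial_x K f (p.1, x)) (partial_x K (partial_x K f) p).
Proof.
by move=> Kx; apply: derivable_within_is_derive => //; exact: (f_reg.2 1%N).
Qed.

Lemma has_derivs_t : (\forall t \near p.1^'+, K (t, p.2)) ->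
  (fun t => (f (t, p.2) - f p) / (t - p.1)) @ p.1^'+ --> partial_t K f p.
Proof.
move=> Kt; have := f_reg.1 0%N p isT Kp => /(derivable_within_cvg_right Kt).
by rewrite -surjective_pairing.
Qed.

End HasDerivs.

(** * One-dimensional barrier profiles *)

Section Barriers.
Variable R : realType.

(** A profile in the distance [y] to a lateral side. The linear bound [B * y] becomes the gradient
    bound; monotonicity makes the profile non-increasing in time when [y = x - zeta t]. *)
Record barrier (phi phi1 phi2 : R -> R) (B : R) : Prop := {
  barrier_le : forall y : R, 0 <= y -> 0 <= phi y <= B * y;
  barrier_continuous : forall y : R, 0 <= y -> {for y, continuous phi};
  barrier_nd : forall x y : R, 0 <= x -> x <= y -> phi x <= phi y;
  barrier_derive : forall y : R, 0 < y -> is_derive y 1 phi (phi1 y);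
  barrier_derive2 : forall y : R, 0 < y -> is_derive y 1 phi1 (phi2 y) }.

(* Exponential barrier [K / l * (1 - exp (- l * y))], [l] beating the drift. *)
Lemma upper_barrier (kappa M C : R) : 0 < kappa -> 0 <= C ->
  exists phi phi1 phi2 B, barrier phi phi1 phi2 B /\
    forall s y, kappa <= s -> 0 < y <= M ->
      s ^+ 2 / 2 * phi2 y + `|phi1 y| / kappa + C < 0.
Proof.
move=> k0 C0.
(* With this [l], [s ^ 2 / 2 * l] is at least [1 + 1 / kappa] for [s >= kappa]: the diffusion term
   beats the drift and leaves [- phi1]. The factor [expR (l * M)] in [K] then keeps [phi1 >= C + 1]
   up to [y = M]. *)
pose l := 2 * (1 + kappa^-1) / kappa ^+ 2.
have ki0 : 0 < kappa^-1 by rewrite invr_gt0.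
have l0 : 0 < l by rewrite /l !(divr_gt0, mulr_gt0, exprn_gt0)// addr_gt0.
pose K := (C + 1) * expR (l * M).
have K0 : 0 < K by rewrite mulr_gt0 ?expR_gt0// ltr_wpDl.
have Kl0 : 0 < K / l by rewrite divr_gt0.
have d (y : R) : is_derive y 1 (fun y => K / l * (1 - expR (- l * y))) (K * expR (- l * y)).
  apply: is_derive_eq; rewrite /GRing.scale /=.
  by field; rewrite gt_eqF.
have d1 (y : R) : is_derive y 1 (fun y => K * expR (- l * y)) (- l * (K * expR (- l * y))).
  by apply: is_derive_eq; rewrite /GRing.scale /=; ring.
exists (fun y => K / l * (1 - expR (- l * y))), (fun y => K * expR (- l * y)),
  (fun y => - l * (K * expR (- l * y))), K.
split.
  split.
  - move=> y y0; have e1 : expR (- l * y) <= 1.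
      by rewrite -expR0 ler_expR mulNr oppr_le0 mulr_ge0// ltW.
    rewrite (mulr_ge0 (ltW Kl0)) ?subr_ge0//=.
    have := expR_ge1Dx (- l * y); rewrite mulNr => h.
    have -> : K * y = K / l * (l * y) by field; rewrite gt_eqF.
    by rewrite (ler_pM2l Kl0); lra.
  - move=> y _; apply: differentiable_continuous; apply/derivable1_diffP.
    by case: (d y).
  - move=> x y x0 xy; rewrite (ler_pM2l Kl0) lerD2l lerN2 ler_expR.
    by rewrite !mulNr lerN2 ler_pM2l.
  - by move=> y _; exact: d.
  - by move=> y _; exact: d1.
move=> s y ks /andP[y0 yM].
set q := K * expR (- l * y).
have q0 : 0 < q by rewrite mulr_gt0 ?expR_gt0.
have qC : C + 1 <= q.
  rewrite /q /K -mulrA -expRD ler_peMr ?addr_ge0// -expR0 ler_expR.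
  by rewrite mulNr subr_ge0 ler_pM2l.
have sk : kappa ^+ 2 <= s ^+ 2.
  by rewrite ler_sqr ?nnegrE// ltW// (lt_le_trans k0).
have lE : kappa ^+ 2 * l = 2 * (1 + kappa^-1).
  by rewrite /l; field; rewrite gt_eqF.
have : kappa ^+ 2 * l * q <= s ^+ 2 * l * q.
  by rewrite ler_pM2r// ler_pM2r.
rewrite lE (gtr0_norm q0) => ?; lra.
Qed.

(* Logarithmic (Hopf-Cole) barrier [ln (1 + b * y) / a]: its second derivative is
   [- a * phi1 ^ 2], which absorbs the quadratic gradient term for [a] large.
   Where [phi] itself does not dominate the constants, [1 + b * y] is bounded
   independently of [b], so that [phi1] is large for [b] large. *)
Lemma lower_barrier (kappa k C : R) : 0 < kappa -> 0 <= k -> 0 <= C ->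
  exists phi phi1 phi2 B, barrier phi phi1 phi2 B /\
    forall s y, kappa <= s -> 0 < y ->
      s ^+ 2 / 2 * phi2 y + `|phi1 y| / kappa + k * phi1 y ^+ 2 + C < phi y.
Proof.
move=> kp0 k0 C0.
have ki0 : 0 < kappa^-1 by rewrite invr_gt0.
(* Here [s ^ 2 / 2 * a >= k + 2], so the second-order term cancels [k * phi1 ^ 2] and leaves
   [- 2 * phi1 ^ 2]. [K] is the threshold above which [phi] absorbs the constants, and [b] is tuned
   to give [phi1 >= 1 + C + 1 / kappa] below it. *)
pose a := 2 * (k + 2) / kappa ^+ 2.
have a0 : 0 < a by rewrite /a !(divr_gt0, mulr_gt0, exprn_gt0)// ltr_wpDl.
pose K := C + kappa^-1 ^+ 2.
pose b := a * expR (a * K) * (1 + C + kappa^-1).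
have c0 : 0 < 1 + C + kappa^-1 by lra.
have b0 : 0 < b by rewrite /b mulr_gt0// mulr_gt0// expR_gt0.
have by0 (y : R) : 0 <= y -> 0 < 1 + b * y.
  by move=> y0; rewrite ltr_wpDr// mulr_ge0// ltW.
have d (y : R) : 0 <= y -> is_derive y 1 (fun y => a^-1 * ln (1 + b * y)) (b / a / (1 + b * y)).
  move=> y0.
  have dl : is_derive y 1 (@ln R \o (fun y => 1 + b * y)) ((1 + b * y)^-1 * b).
    apply: is_derive1_comp; first exact: is_derive1_ln (by0 y y0).
    by apply: is_derive_eq; rewrite /GRing.scale /= add0r mul1r mulr1.
  have dz := @is_deriveZ _ _ _ _ a^-1 _ _ _ dl.
  by apply: (is_derive_eq dz); rewrite /GRing.scale /=; field; rewrite !gt_eqF// by0.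
have d1 (y : R) : 0 <= y -> is_derive y 1 (fun y => b / a / (1 + b * y))
    (- a * (b / a / (1 + b * y)) ^+ 2).
  move=> y0.
  have dl : is_derive y 1 (fun y => (1 + b * y)^-1) (- (1 + b * y) ^- 2 *: b).
    apply: is_deriveV; first by rewrite gt_eqF// by0.
    by apply: is_derive_eq; rewrite /GRing.scale /= add0r mul1r mulr1.
  have dz := @is_deriveZ _ _ _ _ (b / a) _ _ _ dl.
  by apply: (is_derive_eq dz); rewrite /GRing.scale /=; field; rewrite !gt_eqF// by0.
exists (fun y => a^-1 * ln (1 + b * y)), (fun y => b / a / (1 + b * y)),
  (fun y => - a * (b / a / (1 + b * y)) ^+ 2), (b / a).
split.
  split.
  - move=> y y0; rewrite mulr_ge0 ?invr_ge0 ?(ltW a0)//=; last first.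
      by rewrite ln_ge0// lerDl mulr_ge0// ltW.
    rewrite -[b / a * y]mulrA mulrCA ler_pM2l ?invr_gt0// le_ln1Dx//.
    by rewrite (lt_le_trans (ltrN10 R))// mulr_ge0// ltW.
  - move=> y y0; apply: differentiable_continuous; apply/derivable1_diffP.
    by case: (d y y0).
  - move=> x y x0 xy; rewrite ler_pM2l ?invr_gt0// ler_ln ?posrE ?by0//.
      by rewrite lerD2l ler_pM2l.
    exact: le_trans xy.
  - by move=> y /ltW; exact: d.
  - by move=> y /ltW; exact: d1.
move=> s y ks y0.
have yp := by0 y (ltW y0).
set q := b / a / (1 + b * y); set p := a^-1 * ln (1 + b * y).
have q0 : 0 < q by exact: divr_gt0 (divr_gt0 b0 a0) yp.
have p0 : 0 <= p.
  by rewrite mulr_ge0 ?invr_ge0 ?(ltW a0)// ln_ge0// lerDl mulr_ge0// ltW.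
have sk : kappa ^+ 2 <= s ^+ 2.
  by rewrite ler_sqr ?nnegrE// ltW// (lt_le_trans kp0).
have aE : kappa ^+ 2 * a = 2 * (k + 2).
  by rewrite /a; field; rewrite gt_eqF.
have aq : kappa ^+ 2 * a * q ^+ 2 <= s ^+ 2 * a * q ^+ 2.
  by rewrite ler_pM2r ?exprn_gt0// ler_pM2r.
rewrite aE in aq; rewrite (gtr0_norm q0).
suff : C + q / kappa < 2 * q ^+ 2 + p by lra.
(* Above the threshold, [q / kappa] is split by Young's inequality between [q ^ 2] and [kappa ^ -2].
   Below it, [1 + b * y = expR (a * p)] is at most [expR (a * K)], so [q] is large and [q ^ 2]
   dominates. *)
have [pK|pK] := ltP K p.
  have : C + kappa^-1 ^+ 2 < p by [].
  have h1 := sqr_ge0 (q - kappa^-1); have h2 := sqr_ge0 q.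
  have h3 := sqr_ge0 kappa^-1.
  by rewrite sqrrB mulr2n in h1; lra.
have qK : 1 + C + kappa^-1 <= q.
  have yE : 1 + b * y = expR (a * p).
    by rewrite /p mulVKf ?gt_eqF// lnK.
  rewrite /q yE ler_pdivlMr ?expR_gt0// /b.
  rewrite (_ : _ / a = (1 + C + kappa^-1) * expR (a * K)); last first.
    by field; rewrite !gt_eqF.
  by rewrite (ler_pM2l c0) ler_expR ler_pM2l.
have h1 : 0 <= q * (q - (1 + C + kappa^-1)) by rewrite mulr_ge0 ?subr_ge0 ?(ltW q0).
have h2 : 0 <= C * q by rewrite mulr_ge0// ltW.
by have := sqr_ge0 q; lra.
Qed.

End Barriers.

(** * Derivatives and bounds for the product of a cutoff and a payoff *)

Section Localise.
Variables (R : realType) (T gamma L C0 N : R) (xi : R -> R) (g : R * R -> R).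
Notation S := (spacetimebar T).
Notation H := [set` (`[0, +oo[ : interval R)].
Notation dxi := (derive_within H).
Hypotheses (xi_smooth : smooth_on H xi)
  (xi_range : forall x : R, 0 <= x -> 0 <= xi x <= 1)
  (xi_deriv : forall x : R, 0 <= x -> `|dxi xi x| ^+ 2 <= C0 * xi x)
  (xi_deriv2 : forall x : R, 0 <= x -> `|dxi (dxi xi) x| <= C0)
  (g_reg : Cb gamma 1 2 S g)
  (g_range : forall p, S p -> 0 <= g p <= N)
  (g_lip : forall p q, S p -> S q ->
    `|g p - g q| <= L * (`|p.2 - q.2| + `|p.1 - q.1|)).

Notation gm := (fun p : R * R => xi p.2 * g p).

(** This and the next two are the product-rule expressions for the derivatives of [gm], kept
    explicit so that they can be bounded termwise. *)
Definition localise_t (p : R * R) : R := xi p.2 * partial_t S g p.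

Definition localise_x (p : R * R) : R :=
  dxi xi p.2 * g p + xi p.2 * partial_x S g p.

Definition localise_xx (p : R * R) : R :=
  dxi (dxi xi) p.2 * g p + 2 * (dxi xi p.2 * partial_x S g p)
  + xi p.2 * partial_x S (partial_x S g) p.

Lemma near_halfline (x : R) : 0 < x -> \forall y \near x, H y.
Proof.
move=> x0; near=> y; rewrite /= in_itv /= andbT ltW//.
by near: y; exact: lt_nbhsr.
Unshelve. all: by end_near. Qed.

Lemma near_spacetimebar_x (p : R * R) : S p -> 0 < p.2 ->
  \forall x \near p.2, S (p.1, x).
Proof.
move=> [pT _] /near_halfline; apply: filterS => x.
by rewrite /= in_itv /= andbT => x0; split.
Qed.

Lemma near_spacetimebar_t (p : R * R) : S p -> p.1 < T ->
  \forall t \near p.1^'+, S (t, p.2).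
Proof.
move=> [/andP[p0 _] px] pT; near=> t; split=> //=; apply/andP; split.
  by rewrite (le_trans p0)// ltW//; near: t; exact: nbhs_right_gt.
by rewrite ltW//; near: t; exact: nbhs_right_lt.
Unshelve. all: by end_near. Qed.

Lemma cutoff_is_derive (x : R) : 0 < x -> is_derive x 1 xi (dxi xi x).
Proof.
move=> x0; apply: derivable_within_is_derive; first exact: near_halfline.
have := @xi_smooth 0%N x; apply.
by rewrite /= in_itv /= andbT ltW.
Qed.

Lemma cutoff_is_derive2 (x : R) : 0 < x -> is_derive x 1 (dxi xi) (dxi (dxi xi) x).
Proof.
move=> x0; apply: derivable_within_is_derive; first exact: near_halfline.
have := @xi_smooth 1%N x; apply.
by rewrite /= in_itv /= andbT ltW.
Qed.

Lemma localise_is_derive_x (p : R * R) : S p -> 0 < p.2 ->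
  is_derive p.2 1 (fun x => gm (p.1, x)) (localise_x p).
Proof.
move=> Sp p0; have [greg _ _] := g_reg.
have gx := has_derivs_x greg Sp (near_spacetimebar_x Sp p0).
have d1 := @is_deriveM _ _ _ _ _ _ _ _ (cutoff_is_derive p0) gx.
apply: (is_derive_eq d1); rewrite -surjective_pairing /GRing.scale /= /localise_x.
ring.
Qed.

Lemma localise_is_derive_xx (p : R * R) : S p -> 0 < p.2 ->
  is_derive p.2 1 (fun x => localise_x (p.1, x)) (localise_xx p).
Proof.
move=> Sp p0; have [greg _ _] := g_reg.
have Sx := near_spacetimebar_x Sp p0.
have gx := has_derivs_x greg Sp Sx.
have gxx := has_derivs_xx greg Sp Sx.
have d1 := @is_deriveM _ _ _ _ _ _ _ _ (cutoff_is_derive2 p0) gx.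
have d2 := @is_deriveM _ _ _ _ _ _ _ _ (cutoff_is_derive p0) gxx.
apply: (is_derive_eq (is_deriveD d1 d2)); rewrite -surjective_pairing /GRing.scale /= /localise_xx.
ring.
Qed.

Lemma localise_cvg_t (p : R * R) : S p -> p.1 < T ->
  (fun t => (gm (t, p.2) - gm p) / (t - p.1)) @ p.1^'+ --> localise_t p.
Proof.
move=> Sp pT; have [greg _ _] := g_reg.
have gt := has_derivs_t greg Sp (near_spacetimebar_t Sp pT).
have -> : (fun t => (gm (t, p.2) - gm p) / (t - p.1)) =
    (fun t => xi p.2 * ((g (t, p.2) - g p) / (t - p.1))).
  by apply/funext => t; rewrite /= -mulrBr -mulrA.
by apply: cvgM gt; exact: cvg_cst.
Qed.

(** The squared derivative is at most [C0 * xi x], hence at most [|C0|], and a number whose square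
    is at most [|C0|] is at most [1 + |C0|]. The bound is the same for every cutoff index. *)
Lemma cutoff_deriv_le x : 0 <= x -> `|dxi xi x| <= 1 + `|C0|.
Proof.
move=> x0; have /andP[xi0 xi1] := xi_range x0.
have h := xi_deriv x0.
have : C0 * xi x <= `|C0|.
  apply: (le_trans (ler_norm _)); rewrite normrM (ger0_norm xi0).
  by rewrite ler_piMr.
by move: h (normr_ge0 C0) (normr_ge0 (dxi xi x)); nra.
Qed.

Lemma cutoff_lipschitz x y : 0 <= x -> 0 <= y ->
  `|xi x - xi y| <= (1 + `|C0|) * `|x - y|.
Proof.
wlog xy : x y / x <= y => [hw x0 y0|x0 y0].
  have [xy|/ltW yx] := leP x y; first exact: hw.
  by rewrite distrC (distrC x) hw.
(* At [x = 0] only one-sided continuity is available, which the mean value theorem accepts; its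
   intermediate point is positive, where [xi] has a two-sided derivative. *)
have : {within `[x, y], continuous xi}.
  apply/subspace_continuousP => z /=; rewrite in_itv /= => /andP[xz zy].
  have Hz : H z by rewrite /= in_itv /= andbT (le_trans x0).
  have := derivable_within_continuous_within (@xi_smooth 0%N z Hz).
  apply: cvg_trans; apply: cvg_app; apply: within_subset.
  move=> w; rewrite /= !in_itv /= => /andP[xw _].
  by rewrite andbT (le_trans x0).
move=> /(@MVT_segment _ xi (dxi xi) x y xy)[z|c].
  rewrite in_itv /= => /andP[xz _]; apply: cutoff_is_derive.
  exact: le_lt_trans xz.
rewrite in_itv /= => /andP[xc _] h.
rewrite distrC h normrM (distrC x) ler_wpM2r// cutoff_deriv_le//.
exact: le_trans xc.
Qed.

Lemma localise_lipschitz p q : S p -> S q ->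
  `|gm p - gm q| <= ((1 + `|C0|) * N + `|L|) * (`|p.2 - q.2| + `|p.1 - q.1|).
Proof.
move=> Sp Sq; have [_ p0] := Sp; have [_ q0] := Sq.
have /andP[gp0 gpN] := g_range Sp.
have /andP[xi0 xi1] := xi_range q0.
have -> : gm p - gm q = (xi p.2 - xi q.2) * g p + xi q.2 * (g p - g q) by ring.
apply: (le_trans (ler_normD _ _)); rewrite !normrM mulrDl.
rewrite (ger0_norm gp0) (ger0_norm xi0); apply: lerD.
  rewrite mulrAC ler_pM// (le_trans (cutoff_lipschitz p0 q0))//.
  by rewrite ler_wpM2l ?lerDl// addr_ge0.
apply: (@le_trans _ _ `|g p - g q|); first by rewrite ler_piMl.
apply: (le_trans (g_lip Sp Sq)).
by rewrite ler_wpM2r ?ler_norm// addr_ge0.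
Qed.

(** The fourth bound concerns the gradient of [g] before localisation, because the cross term of
    [alpha_m_sq] contains it. *)
Lemma localise_bounded : exists2 G, 0 <= G & forall p, S p ->
  [/\ `|localise_t p| <= G, `|localise_x p| <= G, `|localise_xx p| <= G &
      `|partial_x S g p| <= G].
Proof.
have bd (f : R * R -> R) : [bounded f p | p in S] ->
    exists2 M, 0 <= M & forall p, S p -> `|f p| <= M.
  case=> M [_ MP]; exists (`|M| + 1); first by rewrite addr_ge0.
  by move=> p Sp; apply: MP => //; rewrite (le_lt_trans (ler_norm M))// ltrDl.
have [_ _ [bt bx]] := g_reg.
have [Mt Mt0 MtP] := bd _ (bt 1%N isT).
have [Mx Mx0 MxP] := bd _ (bx 1%N isT).
have [Mxx Mxx0 MxxP] := bd _ (bx 2%N isT).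
set X := 1 + `|C0|.
have X1 : 1 <= X by rewrite lerDl.
have [X0 N0] : 0 <= X /\ 0 <= `|N| by rewrite addr_ge0.
exists (Mt + (X * `|N| + 2 * (X * Mx) + Mx + Mxx)).
  by rewrite !addr_ge0 ?mulr_ge0.
move=> p Sp; have [_ p0] := Sp.
have /andP[g0 gN] := g_range Sp.
have /andP[xi0 xi1] := xi_range p0.
have gN' : `|g p| <= `|N| by rewrite ger0_norm// (le_trans gN)// ler_norm.
have x1 : `|dxi xi p.2| <= X by exact: cutoff_deriv_le.
have x2 : `|dxi (dxi xi) p.2| <= X.
  by rewrite (le_trans (xi_deriv2 p0))// (le_trans (ler_norm _))// lerDr.
have mx : `|partial_x S g p| <= Mx := MxP p Sp.
have mt : `|partial_t S g p| <= Mt := MtP p Sp.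
have mxx : `|partial_x S (partial_x S g) p| <= Mxx := MxxP p Sp.
have XN : 0 <= X * `|N| by rewrite mulr_ge0.
have XM : 0 <= X * Mx by rewrite mulr_ge0.
have xile (a M : R) : `|a| <= M -> `|xi p.2 * a| <= M.
  by move=> aM; rewrite normrM (ger0_norm xi0) (le_trans _ aM)// ler_piMl.
have h1 := xile _ _ mx; have h2 := xile _ _ mt; have h3 := xile _ _ mxx.
have h4 : `|dxi xi p.2 * g p| <= X * `|N| by rewrite normrM ler_pM.
have h5 : `|dxi (dxi xi) p.2 * g p| <= X * `|N| by rewrite normrM ler_pM.
have h6 : `|dxi xi p.2 * partial_x S g p| <= X * Mx by rewrite normrM ler_pM.
move: h1 h2 h3 h4 h5 h6; rewrite /localise_t /localise_x /localise_xx.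
rewrite !ler_norml => /andP[? ?] /andP[? ?] /andP[? ?] /andP[? ?] /andP[? ?].
move=> /andP[? ?]; move: mx; rewrite ler_norml => /andP[? ?].
by split; apply/andP; split; lra.
Qed.

End Localise.

(** * Continuity from Hölder and Lipschitz bounds *)

Section ContinuityWithin.
Variables (R : realType) (K : set (R * R)) (f : R * R -> R).

Lemma within_box (q : R * R) (P : set (R * R)) (e : R) : 0 < e ->
  (forall p, K p -> `|q.1 - p.1| < e -> `|q.2 - p.2| < e -> P p) ->
  within K (nbhs q) P.
Proof.
move=> e0 eP; change (nbhs q [set p | K p -> P p]).
by apply/nbhs_ballP; exists e => //= p [/= p1 p2] Kp; exact: eP.
Qed.

Lemma parabolic_holder_continuous_within (gamma : R) : 0 < gamma ->
  parabolic_holder gamma K f -> {within K, continuous f}.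
Proof.
move=> gamma0 [C fC]; apply/subspace_continuousP => q Kq.
apply/cvgrPdist_lt => e e0.
(* A Hölder constant that is certainly positive. The radius [d] solves [c * d ^ gamma = e]; space
   steps below [d / 2] and time steps below [(d / 2) ^ 2] keep the parabolic distance below [d]. *)
pose c := `|C| + 1.
have c0 : 0 < c by rewrite ltr_wpDl.
pose d := (e / c) `^ gamma^-1.
have d0 : 0 < d by rewrite powR_gt0// divr_gt0.
apply: (@within_box _ _ (Num.min ((d / 2) ^+ 2) (d / 2))).
  by rewrite lt_min exprn_gt0 divr_gt0.
move=> p Kp; rewrite !lt_min => /andP[pt _] /andP[_ px].
have pd : parabolic_dist q p < d.
  rewrite /parabolic_dist [ltRHS]splitr ltrD//.
  rewrite -[ltRHS]ger0_norm ?divr_ge0 ?(ltW d0)// -[ltRHS]sqrtr_sqr.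
  by rewrite ltr_sqrt// exprn_gt0// divr_gt0.
have pd0 : 0 <= parabolic_dist q p by rewrite addr_ge0// sqrtr_ge0.
apply: (le_lt_trans (fC q p Kq Kp)).
have : parabolic_dist q p `^ gamma < e / c.
  have -> : e / c = d `^ gamma.
    by rewrite /d -powRrM mulVf ?gt_eqF// powRr1// ltW// divr_gt0.
  by apply: gt0_ltr_powR => //; rewrite nnegrE// ltW.
rewrite ltr_pdivlMr// => /le_lt_trans; apply.
by rewrite mulrC ler_wpM2l ?powR_ge0// (le_trans (ler_norm C))// lerDl.
Qed.

Lemma lipschitz_continuous_within (L : R) :
  (forall p q, K p -> K q -> `|f p - f q| <= L * (`|p.2 - q.2| + `|p.1 - q.1|)) ->
  {within K, continuous f}.
Proof.
move=> fL; apply/subspace_continuousP => q Kq.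
apply/cvgrPdist_lt => e e0.
pose c := `|L| + 1.
have c0 : 0 < c by rewrite ltr_wpDl.
apply: (@within_box _ _ (e / c / 2)); first by rewrite !divr_gt0.
move=> p Kp pt px; apply: (le_lt_trans (fL q p Kq Kp)).
have : `|q.2 - p.2| + `|q.1 - p.1| < e / c by rewrite [ltRHS]splitr ltrD.
rewrite ltr_pdivlMr// => /le_lt_trans; apply.
by rewrite mulrC ler_wpM2l ?addr_ge0// (le_trans (ler_norm L))// lerDl.
Qed.

End ContinuityWithin.

(** Beyond [2 * eps] the function is explicit, and before it monotonicity bounds it by its value 1
    at [2 * eps]. Evaluated at a squared gradient, this is quadratic growth. *)
Lemma penalty_le (R : realType) (eps : R) (psi : R -> R) (y : R) :
  0 < eps -> penalty eps psi -> psi y <= 1 + `|y| / eps.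
Proof.
move=> eps0 [[psid _ _] _ _ _ _ psi1 psil].
have [ye|/ltW ye] := leP (2 * eps) y.
  rewrite psil// mulrBl divff ?gt_eqF// (@le_trans _ _ (`|y| / eps))//; last first.
    by rewrite lerDr.
  by rewrite (@le_trans _ _ (y / eps)) ?ler_pM2r ?invr_gt0 ?ler_norm// gerBl.
have le2 : psi y <= psi (2 * eps).
  apply: (@ger0_derive1_ndecr _ psi y (2 * eps)) => //.
  by apply: derivable_within_continuous => x _.
apply: (le_trans le2); rewrite psil// (_ : (2 * eps - eps) / eps = 1).
  by rewrite lerDl divr_ge0// ltW.
by field; rewrite gt_eqF.
Qed.

(** * Barrier estimates for the penalised equation and the boundary gradient *)

Section GradientEstimate.
Variables (R : realType) (T : R) (m : nat) (zeta : R -> R).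
Hypotheses (T_gt0 : 0 < T)
  (zeta_cont : forall t, 0 <= t <= T -> zeta @ within `[0, T] (nbhs t) --> zeta t)
  (zeta_nd : forall s t, 0 <= s -> s <= t -> t <= T -> zeta s <= zeta t)
  (zeta0 : 0 <= zeta 0) (zeta_lt : zeta T < m%:R).

Notation D := (Om T m zeta).
Notation Q := (closure D).
Notation bdD := (parabolic_boundary T m (zeta T)%:E zeta).
Let QE := closure_Om T_gt0 zeta_cont zeta_nd zeta0 zeta_lt.

(** The comparison runs once per lateral side, with [y = x - zeta t] and [y = m - x]. These have
    opposite slopes in [x], so the contradiction is required in a form that sees only [|phi1|], and
    one differential inequality serves both sides. *)
Lemma barrier_comparison (phi phi1 phi2 : R -> R) (B : R)
    (v vt vx vxx : R * R -> R) :
  barrier phi phi1 phi2 B ->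
  {within Q, continuous v} ->
  (forall p, bdD p -> v p <= 0) ->
  (forall p, D p -> is_derive p.2 1 (fun x => v (p.1, x)) (vx p)) ->
  (forall p, D p -> is_derive p.2 1 (fun x => vx (p.1, x)) (vxx p)) ->
  (forall p, D p ->
    (fun t => (v (t, p.2) - v p) / (t - p.1)) @ p.1^'+ --> vt p) ->
  (forall p y, D p -> 0 < y <= m%:R -> phi y < v p -> `|vx p| = `|phi1 y| ->
    vxx p <= phi2 y -> vt p <= 0 -> False) ->
  forall p, Q p -> v p <= B * (p.2 - zeta p.1) /\ v p <= B * (m%:R - p.2).
Proof.
move=> [phi_le phi_c phi_nd phi_d phi_d2] vc vbd vxP vxxP vtP absurd.
have bdQ p : bdD p -> Q p.
  rewrite QE; case: p => t x [[[/andP[/= t0 tT] ->]|[/andP[/= t0 tT] ->]]|].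
  - by rewrite /= t0 (ltW tT) lexx (le_trans _ (ltW zeta_lt))// zeta_nd// ltW.
  - by rewrite /= t0 (ltW tT) lexx (le_trans _ (ltW zeta_lt))// zeta_nd// ltW.
  - by move=> [/= ->]; rewrite lee_fin lexx (ltW T_gt0) => -[-> ->].
have yl p : Q p -> 0 <= p.2 - zeta p.1.
  by rewrite QE => -[_ /andP[? _]]; rewrite subr_ge0.
have yr p : Q p -> 0 <= m%:R - p.2.
  by rewrite QE => -[_ /andP[_ ?]]; rewrite subr_ge0.
have DyL p : D p -> 0 < p.2 - zeta p.1 <= m%:R.
  move=> [[/andP[p0 pT] _] /andP[pz pm]]; rewrite subr_gt0 pz/=.
  by rewrite lerBlDr (le_trans (ltW pm))// lerDl (le_trans zeta0)// zeta_nd// ltW.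
have DyR p : D p -> 0 < m%:R - p.2 <= m%:R.
  move=> [[_ p0] /andP[_ pm]]; rewrite subr_gt0 pm/=.
  by rewrite lerBlDr lerDl ltW.
(* The target filter is restricted to [[0, T]] because [zeta] is continuous only relative to that
   interval. *)
have fstc q : Q q -> (fun p : R * R => p.1) @ within Q (nbhs q) --> within `[0, T] (nbhs q.1).
  move=> Qq U [e /= e0 eU]; apply: (within_box e0) => p Qp p1 _; apply: eU => //.
  by move: Qp; rewrite QE => -[? _]; rewrite /= in_itv.
have sndc (q : R * R) : (fun p : R * R => p.2) @ within Q (nbhs q) --> q.2.
  by apply/cvgrPdist_lt => e e0; apply: (within_box e0) => p _ _.
have zc q : Q q -> (fun p : R * R => p.2 - zeta p.1) @ within Q (nbhs q) --> q.2 - zeta q.1.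
  move=> Qq; apply: cvgB; first exact: sndc.
  apply: (cvg_comp _ _ (fstc q Qq)); apply: zeta_cont.
  by move: Qq; rewrite QE => -[].
suff h : forall p, Q p -> v p <= phi (p.2 - zeta p.1) /\ v p <= phi (m%:R - p.2).
  move=> p Qp; have [h1 h2] := h p Qp.
  have /andP[_ h3] := phi_le _ (yl _ Qp); have /andP[_ h4] := phi_le _ (yr _ Qp).
  by split; [exact: le_trans h3|exact: le_trans h4].
move=> p Qp; split.
- apply: (comparison T_gt0 zeta_cont zeta_nd zeta0 zeta_lt
    (P := fun p => phi (p.2 - zeta p.1)) (Px := fun p => phi1 (p.2 - zeta p.1))
    (Pxx := fun p => phi2 (p.2 - zeta p.1)) vc _ _ vxP vxxP _ _ vtP) => //.
  + apply/subspace_continuousP => q Qq.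
    apply: (cvg_comp _ _ (zc q Qq)); exact: phi_c (yl q Qq).
  + move=> q bq; apply: (le_trans (vbd q bq)).
    by have /andP[] := phi_le _ (yl q (bdQ q bq)).
  + move=> q /DyL /andP[/phi_d dq _].
    have dy : is_derive q.2 1 (fun x => x - zeta q.1) 1.
      by apply: is_derive_eq; rewrite subr0.
    by have := @is_derive1_comp _ phi _ q.2 _ _ dq dy; rewrite mulr1.
  + move=> q /DyL /andP[/phi_d2 dq _].
    have dy : is_derive q.2 1 (fun x => x - zeta q.1) 1.
      by apply: is_derive_eq; rewrite subr0.
    by have := @is_derive1_comp _ phi1 _ q.2 _ _ dq dy; rewrite mulr1.
  + move=> s t x Qs Qt st /=; apply: phi_nd; first exact: yl Qt.
    rewrite lerD2l lerN2; move: Qs Qt; rewrite QE => -[/andP[? _] _] [/andP[_ ?] _].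
    exact: zeta_nd.
  + move=> q Dq Pv vxE vxxE vtE.
    by apply: (absurd q _ Dq (DyL q Dq)) => //; rewrite vxE.
(* On the right side the inner slope is [-1]: it flips the sign of [phi1] but not of [phi2], and the
   barrier is constant in time. *)
- apply: (comparison T_gt0 zeta_cont zeta_nd zeta0 zeta_lt
    (P := fun p => phi (m%:R - p.2)) (Px := fun p => - phi1 (m%:R - p.2))
    (Pxx := fun p => phi2 (m%:R - p.2)) vc _ _ vxP vxxP _ _ vtP) => //.
  + apply/subspace_continuousP => q Qq.
    have mc : (fun p : R * R => m%:R - p.2) @ within Q (nbhs q) --> m%:R - q.2.
      by apply: cvgB; [exact: cvg_cst|exact: sndc].
    apply: (cvg_comp _ _ mc); exact: phi_c (yr q Qq).
  + move=> q bq; apply: (le_trans (vbd q bq)).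
    by have /andP[] := phi_le _ (yr q (bdQ q bq)).
  + move=> q /DyR /andP[/phi_d dq _].
    have dy : is_derive q.2 1 (fun x => m%:R - x) (-1).
      by apply: is_derive_eq; rewrite add0r mul1r.
    by have := @is_derive1_comp _ phi _ q.2 _ _ dq dy; rewrite mulrN1.
  + move=> q /DyR /andP[/phi_d2 dq _].
    have dy : is_derive q.2 1 (fun x => m%:R - x) (-1).
      by apply: is_derive_eq; rewrite add0r mul1r.
    have := is_deriveN (@is_derive1_comp _ phi1 _ q.2 _ _ dq dy).
    by rewrite mulrN1 opprK.
  + move=> q Dq Pv vxE vxxE vtE.
    by apply: (absurd q _ Dq (DyR q Dq)) => //; rewrite vxE normrN.
Qed.

Variables (r gamma kappa eps G N A L : R) (mu sigma psi : R -> R)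
  (gm gt gx gxx hm alpha2 : R * R -> R).
Hypotheses (r_ge0 : 0 <= r) (gamma_gt0 : 0 < gamma) (kappa_gt0 : 0 < kappa)
  (eps_gt0 : 0 < eps) (psi_penalty : penalty eps psi)
  (mu_le : forall x, 0 <= x -> `|mu x| <= kappa^-1)
  (sigma_le : forall x, 0 <= x -> kappa <= sigma x <= kappa^-1)
  (gm_x : forall p, D p -> is_derive p.2 1 (fun x => gm (p.1, x)) (gx p))
  (gm_xx : forall p, D p -> is_derive p.2 1 (fun x => gx (p.1, x)) (gxx p))
  (gm_t : forall p, D p ->
    (fun t => (gm (t, p.2) - gm p) / (t - p.1)) @ p.1^'+ --> gt p)
  (gm_lip : forall p q, Q p -> Q q ->
    `|gm p - gm q| <= L * (`|p.2 - q.2| + `|p.1 - q.1|))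
  (gm_range : forall p, D p -> 0 <= gm p <= N)
  (hm_range : forall p, D p -> 0 <= hm p <= N)
  (gt_le : forall p, D p -> `|gt p| <= G)
  (gx_le : forall p, D p -> `|gx p| <= G)
  (gxx_le : forall p, D p -> `|gxx p| <= G)
  (alpha2_le : forall p, D p -> `|alpha2 p| <= A).
Hypotheses (G_ge0 : 0 <= G) (N_ge0 : 0 <= N) (A_ge0 : 0 <= A).

Notation solution delta u :=
  (penalised_solution T r gamma delta mu sigma psi gm hm alpha2 D bdD u).

Let K := kappa^-1.
Let C := G + K ^+ 2 / 2 * G + K * G + r * N + N.

Let K_gt0 : 0 < K. Proof. by rewrite invr_gt0. Qed.

Let C_ge0 : 0 <= C.
Proof. by rewrite !addr_ge0 ?mulr_ge0 ?divr_ge0 ?exprn_ge0 ?(ltW K_gt0). Qed.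

(** Subtracting the equation for [u] leaves this residual of the obstacle as source term of the
    difference. Its bound [C] is free of [delta]. *)
Lemma obstacle_residual_le p : D p ->
  `|gt p + sigma p.2 ^+ 2 / 2 * gxx p + mu p.2 * gx p - r * gm p + hm p| <= C.
Proof.
move=> Dp; have p0 : 0 <= p.2 by case: Dp => -[_ /ltW].
have /andP[ks sK] := sigma_le p0.
have s0 : 0 <= sigma p.2 by rewrite (le_trans (ltW kappa_gt0)).
have /andP[g0 gN] := gm_range Dp; have /andP[h0 hN] := hm_range Dp.
rewrite /C; apply: (le_trans (ler_normD _ _)); apply: lerD; last first.
  by rewrite ger0_norm.
apply: (le_trans (ler_normD _ _)); apply: lerD; last first.
  by rewrite normrN normrM !ger0_norm// ler_wpM2l.
apply: (le_trans (ler_normD _ _)); apply: lerD; last first.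
  by rewrite normrM ler_pM ?mu_le ?gx_le.
apply: (le_trans (ler_normD _ _)); apply: lerD; last first.
  rewrite normrM (ger0_norm (_ : 0 <= _ / 2)) ?divr_ge0 ?exprn_ge0//.
  rewrite ler_pM ?gxx_le// ?divr_ge0 ?exprn_ge0// ler_pM2r ?invr_gt0//.
  by rewrite ler_sqr ?nnegrE// ltW.
exact: gt_le.
Qed.

(** At a contact point with [u > gm], the linear operator applied to [u - gm] is at least [- C],
    since [psi >= 0], while the barrier inequality puts it strictly below [- C]. [B] is fixed before
    [delta]. *)
Lemma solution_upper : exists B, forall delta u, 0 < delta < 1 ->
  solution delta u -> forall p, Q p ->
  u p - gm p <= B * (p.2 - zeta p.1) /\ u p - gm p <= B * (m%:R - p.2).
Proof.
have [phi [phi1 [phi2 [B [bar ineq]]]]] :=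
  upper_barrier m%:R kappa_gt0 C_ge0.
exists B => delta u /andP[d0 d1] [[u_reg u_hold _] pde ubd].
have Qx p : D p -> \forall x \near p.2, Q (p.1, x).
  move=> /(Om_near_x zeta_nd zeta0); apply: filterS => x; exact: subset_closure.
have Qt p : D p -> \forall t \near p.1^'+, Q (t, p.2).
  move=> /(Om_near_t zeta_cont); apply: filterS => x; exact: subset_closure.
apply: (barrier_comparison
  (v := fun p => u p - gm p)
  (vt := fun p => partial_t Q u p - gt p)
  (vx := fun p => partial_x Q u p - gx p)
  (vxx := fun p => partial_x Q (partial_x Q u) p - gxx p) bar).
- move=> q; apply: cvgB.
    exact: (parabolic_holder_continuous_within gamma_gt0 (u_hold.1 0%N isT)).
  exact: lipschitz_continuous_within gm_lip q.
- by move=> p bp; rewrite ubd// subrr.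
- move=> p Dp; have dg := gm_x Dp.
  have du := has_derivs_x u_reg (subset_closure Dp) (Qx p Dp).
  exact: is_deriveB du dg.
- move=> p Dp; have dg := gm_xx Dp.
  have du := has_derivs_xx u_reg (subset_closure Dp) (Qx p Dp).
  exact: is_deriveB du dg.
- move=> p Dp; have ut := has_derivs_t u_reg (subset_closure Dp) (Qt p Dp).
  rewrite (_ : (fun t => _) = (fun t => (u (t, p.2) - u p) / (t - p.1)
      - (gm (t, p.2) - gm p) / (t - p.1))).
    by apply: cvgB; [exact: ut|exact: gm_t].
  by apply/funext => t; rewrite -mulrBl; congr (_ / _); ring.
move=> p y Dp yP phiv vxE vxxE vtE.
have p0 : 0 <= p.2 by case: Dp => -[_ /ltW].
have /andP[ks sK] := sigma_le p0.
have := ineq _ _ ks yP.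
have := obstacle_residual_le Dp.
have /andP[y0 _] := yP.
have phi0 : 0 <= phi y by case/andP: (barrier_le bar (ltW y0)).
have gu : gm p < u p by rewrite -subr_gt0 (le_lt_trans phi0).
have := pde p Dp; rewrite /opL (_ : Num.max _ 0 = 0); last first.
  by apply/max_idPr; rewrite subr_le0 ltW.
have := penalty_ge0 psi_penalty (`|partial_x Q u p| ^+ 2 - alpha2 p).
set Psi := psi _; set ux := partial_x Q u p in vxE *.
set uxx := partial_x Q (partial_x Q u) p in vxxE *.
set ut := partial_t Q u p in vtE *; set s := sigma p.2 in ks sK *.
have h1 : s ^+ 2 / 2 * (uxx - gxx p) <= s ^+ 2 / 2 * phi2 y.
  by rewrite ler_wpM2l// divr_ge0// sqr_ge0.
have h2 : `|mu p.2 * (ux - gx p)| <= `|phi1 y| / kappa.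
  by rewrite normrM vxE mulrC ler_wpM2l// mu_le.
have h3 : 0 <= r * (u p - gm p) by rewrite mulr_ge0// subr_ge0 ltW.
move: h2; rewrite !ler_norml => /andP[_ h2] P0 E /andP[_ Th] In.
by move: vtE h1 h2 h3 P0 E Th In; lra.
Qed.

Lemma solution_lower : exists B, forall delta u, 0 < delta < 1 ->
  solution delta u -> forall p, Q p ->
  gm p - u p <= B * (p.2 - zeta p.1) /\ gm p - u p <= B * (m%:R - p.2).
Proof.
(* The penalty is at most [1 + (ux ^ 2 + A) / eps], and [ux ^ 2 <= 2 * phi1 ^ 2 + 2 * G ^ 2] at a
   contact point. This dictates [2 / eps] as quadratic coefficient of the barrier and the constant
   in [C1]. *)
have E0 : 0 <= (2 * G ^+ 2 + A) / eps.
  by rewrite divr_ge0 ?(ltW eps_gt0)// addr_ge0// mulr_ge0// sqr_ge0.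
have k0 : 0 <= 2 / eps by rewrite divr_ge0// ltW.
have C1 : 0 <= 1 + (2 * G ^+ 2 + A) / eps + C by rewrite addr_ge0 ?C_ge0// addr_ge0.
have [phi [phi1 [phi2 [B [bar ineq]]]]] := lower_barrier kappa_gt0 k0 C1.
exists B => delta u /andP[d0 d1] [[u_reg u_hold _] pde ubd].
have Qx p : D p -> \forall x \near p.2, Q (p.1, x).
  move=> /(Om_near_x zeta_nd zeta0); apply: filterS => x; exact: subset_closure.
have Qt p : D p -> \forall t \near p.1^'+, Q (t, p.2).
  move=> /(Om_near_t zeta_cont); apply: filterS => x; exact: subset_closure.
apply: (barrier_comparison
  (v := fun p => gm p - u p)
  (vt := fun p => gt p - partial_t Q u p)
  (vx := fun p => gx p - partial_x Q u p)
  (vxx := fun p => gxx p - partial_x Q (partial_x Q u) p) bar).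
- move=> q; apply: cvgB.
    exact: lipschitz_continuous_within gm_lip q.
  exact: (parabolic_holder_continuous_within gamma_gt0 (u_hold.1 0%N isT)).
- by move=> p bp; rewrite ubd// subrr.
- move=> p Dp; have dg := gm_x Dp.
  have du := has_derivs_x u_reg (subset_closure Dp) (Qx p Dp).
  exact: is_deriveB dg du.
- move=> p Dp; have dg := gm_xx Dp.
  have du := has_derivs_xx u_reg (subset_closure Dp) (Qx p Dp).
  exact: is_deriveB dg du.
- move=> p Dp; have ut := has_derivs_t u_reg (subset_closure Dp) (Qt p Dp).
  rewrite (_ : (fun t => _) = (fun t => (gm (t, p.2) - gm p) / (t - p.1)
      - (u (t, p.2) - u p) / (t - p.1))).
    by apply: cvgB; [exact: gm_t|exact: ut].
  by apply/funext => t; rewrite -mulrBl; congr (_ / _); ring.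
move=> p y Dp /andP[y0 _] phiv vxE vxxE vtE.
have p0 : 0 <= p.2 by case: Dp => -[_ /ltW].
have /andP[ks sK] := sigma_le p0.
have := ineq _ _ ks y0.
have := obstacle_residual_le Dp.
have phi0 : 0 <= phi y by case/andP: (barrier_le bar (ltW y0)).
have gu : u p < gm p by rewrite -subr_gt0 (le_lt_trans phi0).
have := pde p Dp; rewrite /opL (_ : Num.max _ 0 = gm p - u p); last first.
  by apply/max_idPl; rewrite subr_ge0 ltW.
have := penalty_le (`|partial_x Q u p| ^+ 2 - alpha2 p) eps_gt0 psi_penalty.
set Psi := psi _; set ux := partial_x Q u p in vxE *.
set uxx := partial_x Q (partial_x Q u) p in vxxE *.
set ut := partial_t Q u p in vtE *; set s := sigma p.2 in ks sK *.
have h1 : s ^+ 2 / 2 * (gxx p - uxx) <= s ^+ 2 / 2 * phi2 y.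
  by rewrite ler_wpM2l// divr_ge0// sqr_ge0.
have h2 : `|mu p.2 * (gx p - ux)| <= `|phi1 y| / kappa.
  by rewrite normrM vxE mulrC ler_wpM2l// mu_le.
have h3 : 0 <= r * (gm p - u p) by rewrite mulr_ge0// subr_ge0 ltW.
(* Here [delta] drops out of the estimate: what is kept of the obstacle term is [gm - u], which
   exceeds [phi y] and contradicts the barrier inequality. *)
have h4 : gm p - u p <= delta^-1 * (gm p - u p).
  by rewrite ler_peMl ?subr_ge0 ?(ltW gu)// invf_ge1// ltW.
have h5 : `| `|ux| ^+ 2 - alpha2 p| / eps <=
    2 / eps * phi1 y ^+ 2 + (2 * G ^+ 2 + A) / eps.
  have -> : 2 / eps * phi1 y ^+ 2 + (2 * G ^+ 2 + A) / eps =
      (2 * phi1 y ^+ 2 + 2 * G ^+ 2 + A) / eps by ring.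
  rewrite ler_pM2r ?invr_gt0//.
  have gG : gx p ^+ 2 <= G ^+ 2.
    by rewrite -(real_normK (num_real (gx p))) ler_sqr ?nnegrE// gx_le.
  have vE : (gx p - ux) ^+ 2 = phi1 y ^+ 2.
    by rewrite -(real_normK (num_real (gx p - ux))) vxE real_normK ?num_real.
  have := alpha2_le Dp; rewrite (real_normK (num_real ux)) -vE !ler_norml.
  (* Non-negativity of [(2 * gx - ux) ^ 2] is exactly [ux ^ 2 <= 2 * (gx - ux) ^ 2 + 2 * gx ^ 2]. *)
  have := sqr_ge0 (2 * gx p - ux); have := sqr_ge0 (gx p - ux).
  have := sqr_ge0 ux; have := sqr_ge0 G.
  by move=> ? ? ? ? /andP[? ?]; apply/andP; split; move: gG; lra.
move: h2; rewrite !ler_norml => /andP[_ h2] P0 E /andP[Th _] In.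
by move: phiv vtE h1 h2 h3 h4 h5 P0 E Th In; lra.
Qed.

(** Since [u = gm] at the boundary point, a difference quotient of [u] along the slice is one of
    [gm], bounded by its Lipschitz constant, plus [u - gm] divided by the distance to that point,
    bounded by the barriers. *)
Lemma boundary_gradient : exists2 B, 0 < B & forall delta u, 0 < delta < 1 ->
  solution delta u -> forall p, bdD p -> `|partial_x Q u p| <= B.
Proof.
have [B1 up] := solution_upper; have [B2 lo] := solution_lower.
pose B := `|L| + `|B1| + `|B2|.
have B0 : 0 <= B by rewrite !addr_ge0.
exists (B + 1); first by rewrite ltr_wpDl.
move=> delta u d01 sol p bp.
have {}up q := up delta u d01 sol q; have {}lo q := lo delta u d01 sol q.
have [[u_reg _ _] _ ubd] := sol.
apply: (@le_trans _ _ B); last by rewrite lerDl.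
(* On a lateral side, the distance [y] of the barrier is the distance to [p] within the slice. On
   the terminal side [u = gm] along the whole slice, so the difference vanishes. *)
have [Qp slice bd] : [/\ Q p, zeta p.1 <= p.2 <= m%:R /\ 0 <= p.1 <= T &
    forall q, Q q -> q.1 = p.1 ->
      u q - gm q <= `|B1| * `|q.2 - p.2| /\ gm q - u q <= `|B2| * `|q.2 - p.2|].
  have Qin q : Q q -> 0 <= q.1 <= T /\ zeta q.1 <= q.2 <= m%:R by rewrite QE.
  move: bp => [[|]|].
  - move=> [/andP[p0 pT] pz].
    have sl : zeta p.1 <= p.2 <= m%:R.
      by rewrite pz lexx (le_trans _ (ltW zeta_lt))// zeta_nd// ltW.
    have tT : 0 <= p.1 <= T by rewrite p0 ltW.
    split=> //; first by rewrite QE.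
    move=> q Qq qp; have [_ /andP[qz _]] := Qin q Qq.
    have [h1 _] := up q Qq; have [h2 _] := lo q Qq.
    rewrite pz -qp [`|_ - _|]ger0_norm ?subr_ge0//.
    by split; [apply: (le_trans h1)|apply: (le_trans h2)];
      rewrite ler_wpM2r ?subr_ge0 ?ler_norm.
  - move=> [/andP[p0 pT] pm].
    have sl : zeta p.1 <= p.2 <= m%:R.
      by rewrite pm lexx andbT (le_trans _ (ltW zeta_lt))// zeta_nd// ltW.
    have tT : 0 <= p.1 <= T by rewrite p0 ltW.
    split=> //; first by rewrite QE.
    move=> q Qq qp; have [_ /andP[_ qm]] := Qin q Qq.
    have [_ h1] := up q Qq; have [_ h2] := lo q Qq.
    rewrite pm distrC [`|_ - _|]ger0_norm ?subr_ge0//.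
    by split; [apply: (le_trans h1)|apply: (le_trans h2)];
      rewrite ler_wpM2r ?subr_ge0 ?ler_norm.
  - move=> [pT [zp pm]]; rewrite lee_fin in zp.
    have sl : zeta p.1 <= p.2 <= m%:R by rewrite pT zp.
    have tT : 0 <= p.1 <= T by rewrite pT lexx ltW.
    split=> //; first by rewrite QE.
    move=> q Qq qp; have [_ /andP[qz qm]] := Qin q Qq.
    rewrite ubd ?subrr; first by rewrite !mulr_ge0.
    by right; split; [rewrite qp|rewrite lee_fin -pT -qp].
move: slice => [/andP[zp pm] pT].
(* An end of the slice different from [p.2]; the slice is non-degenerate because [zeta p.1 < m], so
   the segment from [p.2] to [c] lies in it. *)
pose c := if p.2 == m%:R then zeta p.1 else m%:R.
have zm : zeta p.1 < m%:R.
  rewrite (le_lt_trans _ zeta_lt)//; move: pT => /andP[? ?]; exact: zeta_nd.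
have ux := u_reg.2 0%N p isT Qp.
apply: (@derive_within_norm_le _ _ _ _ B c ux).
- rewrite /c; case: (eqVneq p.2 m%:R) => [->|h]; first by rewrite lt_eqF.
  by rewrite eq_sym.
- have Qy y : zeta p.1 <= y <= m%:R -> Q (p.1, y) by move=> h; rewrite QE; split.
  rewrite /c; case: (eqVneq p.2 m%:R) => [pmE y|pmN y].
    rewrite pmE (ltr0_norm (_ : zeta p.1 - m%:R < 0)) ?subr_lt0// => h1.
    rewrite nmulr_lge0 ?invr_lt0 ?subr_lt0// subr_le0 => ym; apply: Qy.
    by move: h1; rewrite ler0_norm ?subr_le0// => ?; apply/andP; split; lra.
  have pm' : p.2 < m%:R by rewrite lt_neqAle pmN.
  rewrite (gtr0_norm (_ : 0 < m%:R - p.2)) ?subr_gt0// => h1.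
  rewrite pmulr_lge0 ?invr_gt0 ?subr_gt0// subr_ge0 => ym; apply: Qy.
  by move: h1; rewrite ger0_norm ?subr_ge0// => ?; apply/andP; split; lra.
move=> y Qy /=; rewrite -surjective_pairing (ubd p bp).
have [h1 h2] := bd (p.1, y) Qy erefl.
have := gm_lip Qy Qp; rewrite /= subrr normr0 addr0 => h3.
have h4 : L * `|y - p.2| <= `|L| * `|y - p.2| by rewrite ler_wpM2r// ler_norm.
have h5 : 0 <= `|B1| * `|y - p.2| by rewrite mulr_ge0.
have h6 : 0 <= `|B2| * `|y - p.2| by rewrite mulr_ge0.
move: h3; rewrite !ler_norml => /andP[h31 h32].
by move: h1 h2 h31 h32 h4 h5 h6; rewrite /B /=; move=> *; apply/andP; split; lra.
Qed.

End GradientEstimate.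

(** * Application of the boundary estimate to the localised data *)

Theorem lemma3p5 (R : realType) (T r alpha gamma : R)
    (mu sigma : R -> R) (D1 Dgamma gamma_sigma : R)
    (g h : R * R -> R) (K0 K1 K2 : R)
    (gN hN : nat -> R * R -> R) (LN alphaN : nat -> R)
    (muk sigmak : R -> R -> R)
    (xi : nat -> R -> R) (C0 : R)
    (N m : nat) (kappa eps : R) (zeta psi : R -> R)
    (thetabar := first_zero (fun x =>
       Theta T r (muk kappa) (sigmak kappa) (hN N) (gN N) (T, x)))
    (thetabar_m := first_zero (fun x =>
       Theta T r (muk kappa) (sigmak kappa)
         (localise xi m (hN N)) (localise xi m (gN N)) (T, x))) :
  0 < T -> 0 <= r -> 0 < alpha ->
  assumption_SDE mu sigma D1 Dgamma gamma_sigma ->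
  assumption_G T r alpha gamma mu sigma g h K0 K1 K2 ->
  approx_payoffs T alpha gamma g h gN hN LN alphaN ->
  approx_coeffs mu sigma D1 Dgamma gamma_sigma muk sigmak ->
  cutoffs xi C0 ->
  (0 < N)%N -> (0 < m)%N -> 0 < kappa < 1 -> 0 < eps < 1 ->
  m%:R^-1 < T ->
  (0%:E < thetabar)%E -> thetabar = thetabar_m -> (thetabar < m%:R%:E)%E ->
  moving_boundary T m thetabar zeta ->
  penalty eps psi ->
  exists2 M2 : R, 0 < M2 &
    forall (delta : R) (u : R * R -> R), 0 < delta < 1 ->
    penalised_solution T r gamma delta (muk kappa) (sigmak kappa) psi
      (localise xi m (gN N)) (localise xi m (hN N))
      (alpha_m_sq T xi N m (alphaN N) (gN N))
      (Om T m zeta) (parabolic_boundary T m thetabar zeta) u ->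
    (ereal_sup [set (`|partial_x (closure (Om T m zeta)) u p|)%:E
               | p in parabolic_boundary T m thetabar zeta] <= M2%:E)%E.
Proof.
move=> T0 r0 _ _ aG ap ac cut N0 m0 k01 e01 mT _ _ thm mb pen.
(* The extended-real first zero is replaced by the real number [zeta T], so the parabolic boundary
   takes the form used in the estimates above. *)
have zT := zeta_terminal mb; rewrite -zT in thm *.
have zeta_lt : zeta T < m%:R by rewrite lte_fin in thm.
have zeta_nd s t := @zeta_nondecreasing _ _ _ _ _ mb s t.
(* As [1 / m < T], time 0 lies in the interval where [zeta] vanishes. *)
have zeta0 : 0 <= zeta 0 by rewrite (zeta_zero mb)// subr_ge0 ltW.
have zeta_cont t : 0 <= t <= T -> zeta @ within `[0, T] (nbhs t) --> zeta t.
  move=> tT; apply: derivable_within_continuous_within.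
  by have := @zeta_smooth _ _ _ _ _ mb 0%N t; apply; rewrite /= in_itv.
have QE := closure_Om T0 zeta_cont zeta_nd zeta0 zeta_lt.
have QS p : closure (Om T m zeta) p -> spacetimebar T p.
  rewrite QE => -[tT /andP[zp _]]; split=> //; rewrite (le_trans _ zp)//.
  by move/andP: tT => [? ?]; rewrite (le_trans zeta0)// zeta_nd.
have DS p : Om T m zeta p -> spacetimebar T p.
  by move=> /subset_closure /QS.
have Dx p : Om T m zeta p -> 0 < p.2 by case=> -[].
have Dt p : Om T m zeta p -> p.1 < T by case=> -[/andP[]].
have g_range p : spacetimebar T p -> 0 <= gN N p <= N%:R.
  move=> Sp; have /andP[-> _] := approx_g_le ap N0 Sp.
  have /andP[h0 _] := approx_h_le ap N0 Sp.
  by rewrite (le_trans _ (approx_sum_le ap N0 Sp))// lerDl.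
have h_range p : spacetimebar T p -> 0 <= hN N p <= N%:R.
  move=> Sp; have /andP[-> _] := approx_h_le ap N0 Sp.
  have /andP[g0 _] := approx_g_le ap N0 Sp.
  by rewrite (le_trans _ (approx_sum_le ap N0 Sp))// lerDr.
have g_reg := approx_g_reg ap N0.
have g_lip p q := @approx_g_lipschitz _ _ _ _ _ _ _ _ _ _ ap N p q N0.
have xi_smooth := cutoff_smooth cut.
have xi_range n x := @cutoff_range _ _ _ cut n x.
have xi_deriv n x := @cutoff_deriv _ _ _ cut n x.
have xi_deriv2 n x := @cutoff_deriv2 _ _ _ cut n x.
have loc_range (f : R * R -> R) p : spacetimebar T p -> 0 <= f p <= N%:R ->
    0 <= localise xi m f p <= N%:R.
  move=> [_ p0] /andP[f0 fN]; have /andP[x0 x1] := xi_range m.-1 _ p0.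
  by rewrite /localise mulr_ge0//= (le_trans _ fN)// ler_piMl.
have [G G0 GP] := localise_bounded (xi_range m.-1) (xi_deriv m.-1)
  (xi_deriv2 m.-1) g_reg g_range.
(* [X] bounds the cutoff derivative for every index. This matters because [alpha_m_sq] uses the
   cutoff [m] while the localised data use [m.-1]; [A] then bounds [alpha_m_sq] term by term. *)
pose X := 1 + `|C0|.
pose A := alphaN N ^+ 2 + N%:R ^+ 2 * X ^+ 2 + 2 * N%:R * X * G.
have X0 : 0 <= X by rewrite addr_ge0.
have A0 : 0 <= A.
  by rewrite !(sqr_ge0, addr_ge0, mulr_ge0).
have [k0 k1] := andP k01; have [e0 _] := andP e01.
have [gamma0 _] := andP (G_gamma aG).
have mu_le (x : R) : 0 <= x -> `|muk kappa x| <= kappa^-1.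
  by move=> x0; have [] := coeffs_bounds ac k01 x0.
have sigma_le (x : R) : 0 <= x -> kappa <= sigmak kappa x <= kappa^-1.
  by move=> x0; have [] := coeffs_bounds ac k01 x0.
have alpha_le p : Om T m zeta p -> `|alpha_m_sq T xi N m (alphaN N) (gN N) p| <= A.
  move=> /DS Sp; have [_ p0] := Sp; rewrite /alpha_m_sq /A.
  have dX := cutoff_deriv_le (xi_range m) (xi_deriv m) p0.
  have /andP[g0 gN'] := g_range p Sp; have /andP[x0 x1] := xi_range m _ p0.
  have [_ _ _ gxG] := GP p Sp.
  apply: (le_trans (ler_normD _ _)); apply: lerD.
    rewrite ger0_norm ?(sqr_ge0, addr_ge0, mulr_ge0)//.
    by rewrite lerD2l ler_wpM2l ?sqr_ge0// ler_sqr ?nnegrE.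
  rewrite normrM ler_pM// normrM ler_pM// !normrM (ger0_norm g0) (ger0_norm x0).
  by rewrite ger0_norm// -mulrA ler_pM2l// (le_trans _ gN')// ler_piMr.
have [B B0 BP] := boundary_gradient T0 zeta_cont zeta_nd zeta0 zeta_lt r0 gamma0
  k0 e0 pen mu_le sigma_le
  (fun p Dp => localise_is_derive_x (xi_smooth m.-1) g_reg (DS p Dp) (Dx p Dp))
  (fun p Dp => localise_is_derive_xx (xi_smooth m.-1) g_reg (DS p Dp) (Dx p Dp))
  (fun p Dp => localise_cvg_t (xi := xi m.-1) g_reg (DS p Dp) (Dt p Dp))
  (fun p q Qp Qq => localise_lipschitz (xi_smooth m.-1) (xi_range m.-1)
     (xi_deriv m.-1) g_range g_lip (QS p Qp) (QS q Qq))
  (fun p Dp => loc_range (gN N) p (DS p Dp) (g_range p (DS p Dp)))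
  (fun p Dp => loc_range (hN N) p (DS p Dp) (h_range p (DS p Dp)))
  (fun p Dp => let: And4 h _ _ _ := GP p (DS p Dp) in h)
  (fun p Dp => let: And4 _ h _ _ := GP p (DS p Dp) in h)
  (fun p Dp => let: And4 _ _ h _ := GP p (DS p Dp) in h)
  alpha_le G0 (ler0n _ N) A0.
exists B => // delta u d01 sol; apply: ge_ereal_sup => _ [p bp <-].
by rewrite lee_fin; exact: BP sol p bp.
Qed.
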